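(* Let $\Gamma$ be a rooted (connected, with countable vertex set) graph with controlled cycles and with uniformly bounded degrees of vertices, and let $P(\Gamma)$ be the associated metric space of simple paths starting at the root (the coarse disjoint union of the spaces $P_v(\Gamma)$, $v\in V(\Gamma)$, with the symmetric difference metric on each). If $P(\Gamma)$ is not of bounded geometry then it contains a subset which (with the induced metric) has bounded geometry and does not have property A.
   Context: Graphs. A graph $\Gamma=(V,E)$ (possibly infinite) is undirected, has no self-loops, but may have multiple edges between two vertices. A path is a sequence of edges $(e_1,\ldots,e_n)$ such that each $e_i$ connects vertices $v_{i-1}$ and $v_i$, $i=1,\ldots,n$; it is also written $[v_0,v_1,\ldots,v_n]$, and its length is the number $n$ of edges. It is simple if $v_0,\ldots,v_n$ are all different. It is a cycle if $v_0,\ldots,v_{n-1}$ are all different, $v_n=v_0$, and its edges are distinct. Simple paths (with given starting point) and cycles are viewed as subsets of $E$. A graph is rooted if one vertex $v_0$ (the root) is fixed. Controlled cycles. Let $\Gamma$ be connected. A path $\gamma$ intersects a cycle $C$ if $\gamma\cap C\neq\emptyset$ as sets of edges. Two paths $\gamma,\delta$ diverge on $C$ if they both intersect $C$ and $C$ is the disjoint union of the edge sets $\gamma\cap C$ and $\delta\cap C$. For simple paths $\gamma,\delta$ with the same endpoints, write $\gamma\sim_n\delta$ if $\gamma$ and $\delta$ do not diverge on any cycle of length $>n$. $\Gamma$ is a graph with controlled cycles if, for every $n\in\mathbb N$ and every choice of fixed endpoints, $\sim_n$ is an equivalence relation on the set of simple paths of $\Gamma$ with these endpoints. The space $P(\Gamma)$.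 $S(\Gamma)$ is the set of all simple paths starting at the root $v_0$, and $P_v(\Gamma)\subset S(\Gamma)$ is the subset of those with endpoint $v\in V$ (the trivial path without edges is the element of $P_{v_0}(\Gamma)$). The metric on $S(\Gamma)$ and its subsets is $d(\gamma,\delta)=|\gamma\Delta\delta|$, the number of edges lying in exactly one of the two paths. $P(\Gamma)=\sqcup_{v\in V}P_v(\Gamma)$ is the coarse disjoint union of the spaces $(P_v(\Gamma),d)$. Coarse disjoint union. For a (finite or countable) sequence of metric spaces $(X_n,d_n)$, it is $\sqcup_n X_n$ with a metric $d$ equal to $d_n$ on each $X_n$ and $d(y_n,y_m)=d_n(y_n,x_n)+d_m(y_m,x_m)+\alpha_{nm}$ for $y_n\in X_n$, $y_m\in X_m$, $n\neq m$, where $x_i\in X_i$ are fixed points and $\alpha_{nm}=\alpha_{mn}>0$ are numbers with $\lim_{n,m\to\infty,\,n\ne m}\alpha_{nm}=\infty$, meaning that for each $K$ only finitely many pairs $n\neq m$ have $\alpha_{nm}\le K$, chosen so that $d$ is a metric (e.g. $\alpha_{nm}=n+m$). It is well defined up to coarse equivalence. Coarse notions for a discrete metric space $X$, with $B_r(x)=\{y\in X: d_X(x,y)<r\}$: - $X$ has bounded geometry if for any $r>0$ there is $C_r$ such that $|B_r(x)|\le C_r$ for all $x\in X$. - $X$ has property A if for any $R>0$, $\epsilon>0$ there exist $S>0$ and finite non-empty subsets $A_x\subset X\times\mathbb N$, $x\in X$, such that $\frac{|A_x\Delta A_y|}{|A_x\cap A_y|}<\epsilon$ (in particular $A_x\cap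 A_y\ne\emptyset$) if $d_X(x,y)\le R$, and $A_x\subset B_S(x)\times\mathbb N$ for any $x\in X$. *)

(* Defs.v *)
From HB Require Import structures.
From Corelib Require Import RelationClasses.
From mathcomp Require Import all_boot all_order all_algebra finmap.
From mathcomp Require Import all_classical all_reals all_analysis.

Set Implicit Arguments.
Unset Strict Implicit.
Unset Printing Implicit Defensive.

Import Order.TTheory GRing.Theory Num.Theory.

Local Open Scope fset_scope.
Local Open Scope classical_set_scope.
Local Open Scope card_scope.
Local Open Scope ring_scope.

(* Distinct edges may have the same pair of endpoints; loops are excluded by
   [ends_card]. *)
Record multigraph := Multigraph {
  vertex : choiceType;
  edge : choiceType;
  ends : edge -> {fset vertex};
  ends_card : forall e, #|` ends e| = 2%N }.

Section Paths.
Variable G : multigraph.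
Local Notation V := (vertex G).
Local Notation E := (edge G).

(* The edges [es] lead from [u] successively through the vertices [vs], so
   that the vertices visited are [u :: vs]. *)
Fixpoint walk (u : V) (es : seq E) (vs : seq V) : bool :=
  match es, vs with
  | [::], [::] => true
  | e :: es', w :: vs' => (ends e == [fset u; w]%fset) && walk w es' vs'
  | _, _ => false
  end.

Definition connected_graph : Prop :=
  forall u v : V, exists es vs, walk u es vs /\ last u vs = v.

Definition bounded_degree : Prop :=
  exists D : nat, forall v : V, [set e : E | v \in ends e] #<= `I_D.

Definition is_simple_path (u v : V) (A : {fset E}) : Prop :=
  exists es vs, [/\ walk u es vs, last u vs = v, uniq (u :: vs)
                  & A = [fset e in es]%fset].

(* [belast u vs] is the sequence of visited vertices without the last one. *)
Definition is_cycle (C : {fset E}) : Prop :=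
  exists u es vs, [/\ walk u es vs, last u vs = u, uniq (belast u vs),
                      uniq es & C = [fset e in es]%fset].

(* A simple path with given starting point is determined by its edge set. *)
Definition simple_path (u v : V) : Type :=
  set_type [set A : {fset E} | is_simple_path u v A].

HB.instance Definition _ (u v : V) := Choice.on (simple_path u v).

Definition edges (u v : V) (p : simple_path u v) : {fset E} := val p.

Definition diverge (u v : V) (p q : simple_path u v) (C : {fset E}) : Prop :=
  [/\ (edges p `&` C)%fset <> fset0, (edges q `&` C)%fset <> fset0,
      [disjoint edges p `&` C & edges q `&` C]%fset
    & C = ((edges p `&` C) `|` (edges q `&` C))%fset].

Definition sim (n : nat) (u v : V) (p q : simple_path u v) : Prop :=
  forall C : {fset E}, is_cycle C -> (n < #|` C|)%N -> ~ diverge p q C.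

Definition controlled_cycles : Prop :=
  forall (n : nat) (u v : V), Equivalence (@sim n u v).

End Paths.

Definition fsymdiff (T : choiceType) (A B : {fset T}) : {fset T} :=
  ((A `\` B) `|` (B `\` A))%fset.

Lemma in_fsymdiff (T : choiceType) (A B : {fset T}) x :
  (x \in fsymdiff A B) = (x \in A) (+) (x \in B).
Proof. by rewrite !inE; case: (x \in A); case: (x \in B). Qed.

(* [simple_path u v] with the symmetric difference metric; the argument [R]
   only serves to record the field in which the metric takes its values. *)
Definition path_component (R : realType) (G : multigraph) (u v : vertex G)
  : Type := simple_path u v.

Section PathMetric.
Variables (R : realType) (G : multigraph) (u v : vertex G).

HB.instance Definition _ := Choice.on (path_component R u v).

Definition path_dist (p q : path_component R u v) : R :=
  (#|` fsymdiff (edges p) (edges q)|)%:R.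

Lemma path_distxx p : path_dist p p = 0.
Proof. by rewrite /path_dist /fsymdiff fsetDv fsetU0 cardfs0. Qed.

Lemma path_dist_positivity p q : path_dist p q = 0 -> p = q.
Proof.
move/eqP; rewrite /path_dist pnatr_eq0 cardfs_eq0 => /eqP pq0.
apply: val_inj; apply/fsetP => x.
have := in_fsymdiff (edges p) (edges q) x; rewrite pq0 inE => /esym.
by rewrite /edges; case: (x \in _); case: (x \in _).
Qed.

Lemma path_dist_sym p q : path_dist p q = path_dist q p.
Proof. by rewrite /path_dist /fsymdiff fsetUC. Qed.

Lemma path_dist_triangle q p r :
  path_dist p r <= path_dist p q + path_dist q r.
Proof.
rewrite /path_dist -natrD ler_nat.
apply: (@leq_trans #|` fsymdiff (edges p) (edges q)
                    `|` fsymdiff (edges q) (edges r)|%fset); last first.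
  by rewrite cardfsU leq_subr.
apply/fsubset_leq_card/fsubsetP => x; rewrite in_fsetU !in_fsymdiff.
by case: (x \in _); case: (x \in _); case: (x \in _).
Qed.

HB.instance Definition _ := isMetric.Build R (path_component R u v)
  path_distxx path_dist_positivity path_dist_sym path_dist_triangle.

End PathMetric.

Section CoarseDisjointUnion.
Variables (R : realType) (I : choiceType) (X : I -> metricType R).

(* [tagged_as s t] is the point of [t] transported to the component of [s]. *)
Definition cdu_dist (base : forall i, X i) (alpha : I -> I -> R)
    (s t : {i : I & X i}) : R :=
  if tag s == tag t then mdist (tagged s) (tagged_as s t)
  else mdist (tagged s) (base (tag s)) + mdist (tagged t) (base (tag t))
       + alpha (tag s) (tag t).

Local Notation point := (Tagged (fun k => X k : Type)).

Lemma cdu_dist_same base alpha i (x y : X i) :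
  cdu_dist base alpha (point x) (point y) = mdist x y.
Proof. by rewrite /cdu_dist eqxx tagged_asE. Qed.

Lemma cdu_dist_diff base alpha i j (x : X i) (y : X j) : i != j ->
  cdu_dist base alpha (point x) (point y) =
  mdist x (base i) + mdist y (base j) + alpha i j.
Proof. by rewrite /cdu_dist /= => /negPf ->. Qed.

Record cdu_data := CduData {
  cdu_base : forall i, X i;
  cdu_alpha : I -> I -> R;
  cdu_alphaC : forall i j, i != j -> cdu_alpha i j = cdu_alpha j i;
  cdu_alpha_gt0 : forall i j, i != j -> 0 < cdu_alpha i j;
  cdu_alpha_lim : forall K : R,
    finite_set [set p : I * I | p.1 != p.2 /\ cdu_alpha p.1 p.2 <= K];
  cdu_triangle : forall t s w,
    cdu_dist cdu_base cdu_alpha s w <=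
    cdu_dist cdu_base cdu_alpha s t + cdu_dist cdu_base cdu_alpha t w }.

Definition cdu (D : cdu_data) : Type := {i : I & X i}.

Section Metric.
Variable D : cdu_data.

HB.instance Definition _ := Choice.on (cdu D).

Let dist (s t : cdu D) : R := cdu_dist (cdu_base D) (cdu_alpha D) s t.

Let distxx s : dist s s = 0.
Proof. by case: s => i x; rewrite /dist cdu_dist_same mdistxx. Qed.

Let dist_positivity s t : dist s t = 0 -> s = t.
Proof.
case: s t => [i x] [j y]; rewrite /dist; have [ij|ij] := eqVneq i j.
  by case: j / ij y => y; rewrite cdu_dist_same => /mdist_positivity ->.
rewrite cdu_dist_diff// => /eqP; rewrite gt_eqF//.
by rewrite ltr_wpDl ?cdu_alpha_gt0// addr_ge0 ?mdist_ge0.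
Qed.

Let dist_sym s t : dist s t = dist t s.
Proof.
case: s t => [i x] [j y]; rewrite /dist; have [ij|ij] := eqVneq i j.
  by case: j / ij y => y; rewrite !cdu_dist_same metric_sym.
have ji : j != i by rewrite eq_sym.
by rewrite !cdu_dist_diff// (cdu_alphaC D ij) [mdist x _ + _]addrC.
Qed.

HB.instance Definition _ := isMetric.Build R (cdu D)
  distxx dist_positivity dist_sym (@cdu_triangle D).

End Metric.
End CoarseDisjointUnion.

(* The choices of base points and of the numbers alpha entering the definition
   of the coarse disjoint union P(G) of the spaces P_v(G). *)
Definition path_space_data (R : realType) (G : multigraph) (root : vertex G) :=
  cdu_data (fun v : vertex G => path_component R root v : metricType R).

Definition path_space (R : realType) (G : multigraph) (root : vertex G)
  (D : path_space_data R root) : metricType R := cdu D.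

Section CoarseNotions.
Variables (R : realType) (X : metricType R).

(* Both notions are those of the space [Y] with the metric induced from [X];
   the space [X] itself is [Y = setT]. *)
Definition bounded_geometry (Y : set X) : Prop :=
  forall r : R, 0 < r -> exists C : nat,
    forall x : X, Y x -> (ball x r `&` Y) #<= `I_C.

Definition property_A (Y : set X) : Prop :=
  forall r eps : R, 0 < r -> 0 < eps ->
  exists (S : R) (A : X -> {fset X * nat}),
  [/\ 0 < S,
      forall x, Y x -> A x <> fset0,
      forall x, Y x -> forall p, p \in A x -> Y p.1 /\ ball x S p.1
    & forall x y, Y x -> Y y -> mdist x y <= r ->
        (A x `&` A y)%fset <> fset0 /\
        (#|` fsymdiff (A x) (A y)|)%:R / (#|` A x `&` A y|%fset)%:R < eps].

End CoarseNotions.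

(* Main.v *)
Require Import Defs.
From mathcomp Require Import zify fingroup perm.
From mathcomp Require Import all_boot all_order all_algebra finmap.
From mathcomp Require Import all_classical all_reals all_analysis.
From mathcomp Require Import finmap.

(** Two paths [g], [d] with the same endpoints diverge on a cycle [C] exactly
    when [C] is contained in their symmetric difference.  Transitivity of the
    relations [sim n] therefore makes every cycle of the graph isometrically
    embedded, which excludes subdivisions of K4.  This in turn implies that
    switching [g] along one connected component of the symmetric difference of
    [g] and [d] gives again a simple path, and that switches along disjoint
    components can be performed independently.

    If P(G) does not have bounded geometry then, by bounded degree, some paths
    admit arbitrarily many disjoint switches of bounded size, so that P(G)
    contains bi-Lipschitz images, with uniform constants, of Hamming cubes of
    arbitrary dimension, as far apart as we want.  In the cube of all edge sets
    of a finite 3-regular graph of large girth, the sets with boundary {x0, x}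
    form the Z/2-homology cover of the graph (Arzhantseva, Guentner and Spakula);
    its Hamming balls of small radius agree with balls in a tree.  Hence the
    union of these covers has bounded geometry, while property A would give
    finite subsets of a 3-regular tree with small boundary. *)

Set Implicit Arguments.
Unset Strict Implicit.
Unset Printing Implicit Defensive.

Local Open Scope fset_scope.
Local Open Scope nat_scope.

(** Parity replaces the order of edges along a path. For [u != v], an edge set whose odd vertices
    are exactly [u] and [v] contains a path from [u] to [v] whose complement is even, and an even
    subset of a path is empty. A switch can thus fail only by splitting off a nonempty even set, and
    it is this that has to be excluded. Disjoint switches come from packing: if few of them fit
    disjointly, their vertices meet all the others, and bounded degree then confines the differences
    with all nearby paths to a bounded set of edges. The cubes themselves cannot serve as the
    subset, because their balls of a fixed radius grow with the dimension; hence the passage to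
    homology covers inside them. The scale at which property A fails must be the same for all
    pieces, so the size [r] of a switch is fixed while the number of switches grows. The tolerance
    1/3 is one over the degree: a finite subset [T] of a 3-regular tree has at least [#|T|] boundary
    edges, which is too many if each of the three neighbours loses less than a third. *)

Lemma card_le_fsetP (T : choiceType) (S : set T) n :
  (S #<= `I_n)%card <-> exists2 A : {fset T}, #|` A| <= n & forall x, S x -> x \in A.
Proof.
split=> [Sn|[A An SA]].
  have Sfin : finite_set S by apply/finite_set_leP; exists n.
  exists (fset_set S); first exact: geq_card_fset_set.
  by move=> x Sx; rewrite in_fset_set// mem_set.
have Sfin : finite_set S by apply: sub_finite_set (finite_fset A) => x /SA.
have [m Sm] := (finite_setP _).1 Sfin.
rewrite (card_le_eql Sm) card_le_II.
rewrite -(card_fset_set Sm); apply: leq_trans An; apply: fsubset_leq_card.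
by apply/fsubsetP => x; rewrite in_fset_set// => /set_mem/SA.
Qed.

Lemma card_bigfcup_seq (I T : choiceType) (s : seq I) (F : I -> {fset T}) k :
  (forall i, #|` F i| <= k) -> #|` \bigcup_(i <- s) F i| <= size s * k.
Proof.
move=> Fk; elim: s => [|i s IH]; first by rewrite big_nil cardfs0.
rewrite big_cons cardfsU mulSn; apply: leq_trans (leq_subr _ _) _.
exact: leq_add.
Qed.

(** * Graphs with controlled cycles *)

Section Graph.
Variable G : multigraph.
Local Notation V := (vertex G).
Local Notation E := (edge G).
Implicit Types (e : E) (u v w x y z : V) (A B C : {fset E}) (W X : {fset V}).

Lemma ends_inhabited e : exists x, x \in ends e.
Proof. by apply/fset0Pn; rewrite -cardfs_gt0 ends_card. Qed.

Lemma ends_pair e u : u \in ends e -> exists2 w, w != u & ends e = [fset u; w].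
Proof.
move=> ue; have := ends_card e; rewrite (cardfsD1 u) ue add1n => -[] /eqP.
case/cardfs1P => w ew; exists w.
  have : w \in ends e `\ u by rewrite ew inE.
  by rewrite !inE => /andP[].
by rewrite -(fsetD1K ue) ew.
Qed.

Lemma ends_neq e u w : ends e = [fset u; w] -> u != w.
Proof.
move=> ee; have := ends_card e; rewrite ee cardfs2.
by case: (u == w).
Qed.

Inductive spath : V -> V -> {fset E} -> {fset V} -> Prop :=
| spath_nil u : spath u u fset0 [fset u]
| spath_cons u w v e A W : ends e = [fset u; w] -> spath w v A W ->
    u \notin W -> spath u v (e |` A) (u |` W).

Lemma spath_start u v A W : spath u v A W -> u \in W.
Proof. by case=> *; rewrite !inE eqxx. Qed.

Lemma spath_end u v A W : spath u v A W -> v \in W.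
Proof.
by elim=> [x|x w y e B X _ _ yX _]; rewrite !inE ?eqxx// yX orbT.
Qed.

Lemma spath_ends u v A W e x :
  spath u v A W -> e \in A -> x \in ends e -> x \in W.
Proof.
elim=> [?|a b c f B X fe bX IH _]; first by rewrite inE.
rewrite !inE => /orP[/eqP->|eB xe]; last by rewrite IH ?orbT.
rewrite fe !inE => /orP[->//|/eqP->].
by rewrite (spath_start bX) orbT.
Qed.

Lemma spath_edge e u w : ends e = [fset u; w] -> spath u w [fset e] [fset u; w].
Proof.
move=> ee; have := spath_cons ee (spath_nil w); rewrite fsetU0; apply.
by rewrite inE (ends_neq ee).
Qed.

Lemma spath_cat u v w A W B X : spath u v A W -> spath v w B X ->
  (forall x, x \in W -> x \in X -> x = v) -> spath u w (A `|` B) (W `|` X).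
Proof.
move=> uv; elim: uv w B X => [x|a b c f C Y fe bc IH aY] w B X vw dis.
  suff <- : X = [fset x] `|` X by rewrite fset0U.
  by apply/esym/fsetUidPr; rewrite fsub1set (spath_start vw).
rewrite -!fsetUA; apply: (spath_cons fe).
  by apply: IH => // x xY xX; apply: dis => //; rewrite !inE xY orbT.
rewrite inE negb_or aY; apply/negP => aX.
have ac : a = c by apply: dis => //; rewrite !inE eqxx.
by move: aY; rewrite ac (spath_end bc).
Qed.

Lemma spath_rev u v A W : spath u v A W -> spath v u A W.
Proof.
elim=> [x|a b c f C Y fe bc IH aY]; first exact: spath_nil.
rewrite fsetUC; rewrite fsetUC in fe.
suff -> : a |` Y = Y `|` [fset b; a].
  apply: (spath_cat IH (spath_edge fe)) => x xY; rewrite !inE.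
  by case/orP=> /eqP // xa; move: aY; rewrite -xa xY.
apply/fsetP => z; rewrite !inE; case: eqP => [->|]; first by rewrite !orbT.
by rewrite orbF; case: eqP => [->|]; rewrite ?orbF// (spath_start bc).
Qed.

(** The cut is at the first vertex in [S], so that the initial piece meets [S] only at its end.
    Connecting paths are trimmed this way until they meet given sets only at their ends. *)
Lemma spath_first (S : pred V) u v A W x : spath u v A W -> x \in W -> S x ->
  exists y A1 W1 A2 W2, [/\ S y, spath u y A1 W1 & spath y v A2 W2] /\
    [/\ A = A1 `|` A2, W = W1 `|` W2, (forall z, z \in W1 -> z \in W2 -> z = y)
      & forall z, z \in W1 -> S z -> z = y].
Proof.
move=> uv; elim: uv x => [a|a b c f C Y fe bc IH aY] x xW Sx.
  exists a, fset0, [fset a], fset0, [fset a]; move: xW; rewrite inE => /eqP ax.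
  split; split; rewrite -?ax// ?fsetUid ?fsetU0//; try exact: spath_nil.
  - by move=> z; rewrite inE => /eqP.
  - by move=> z; rewrite inE => /eqP.
have [Sa|Sa] := boolP (S a).
  exists a, fset0, [fset a], (f |` C), (a |` Y); split; split=> //.
  - exact: spath_nil.
  - exact: spath_cons fe bc aY.
  - by rewrite fset0U.
  - by rewrite fsetUA fsetUid.
  - by move=> z; rewrite inE => /eqP.
  - by move=> z; rewrite inE => /eqP.
have {xW} xY : x \in Y.
  by move: xW; rewrite !inE => /orP[/eqP xa|//]; move: Sa; rewrite -xa Sx.
have [y [A1 [W1 [A2 [W2 [[Sy p1 p2] [CE YE d1 d2]]]]]]] := IH x xY Sx.
exists y, (f |` A1), (a |` W1), A2, W2; split; split=> //.
- apply: (spath_cons fe p1); apply: contra aY => aW1.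
  by rewrite YE inE aW1.
- by rewrite CE fsetUA.
- by rewrite YE fsetUA.
- move=> z; rewrite !inE => /orP[/eqP->|]; last exact: d1.
  by move=> aW2; move: aY; rewrite YE inE aW2 orbT.
- move=> z; rewrite !inE => /orP[/eqP->|]; last exact: d2.
  by move=> aS; move: Sa; rewrite aS.
Qed.

Lemma spath_split u v A W x : spath u v A W -> x \in W ->
  exists A1 W1 A2 W2, [/\ spath u x A1 W1, spath x v A2 W2,
    A = A1 `|` A2, W = W1 `|` W2 & forall z, z \in W1 -> z \in W2 -> z = x].
Proof.
move=> uv xW.
have [y [A1 [W1 [A2 [W2 [[/eqP-> p1 p2] [CE YE d1 _]]]]]]] :=
  spath_first (S := pred1 x) uv xW (eqxx x).
by exists A1, W1, A2, W2.
Qed.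

(** * Vertex sets and reachability *)

Definition vset A : {fset V} := \bigcup_(e <- A) ends e.

Lemma vsetP A x : reflect (exists2 e, e \in A & x \in ends e) (x \in vset A).
Proof.
apply: (iffP (bigfcupP _ _ _ _)) => [[e]|[e eA xe]].
  by rewrite andbT => eA xe; exists e.
by exists e => //; rewrite eA.
Qed.

Lemma mem_vset A e x : e \in A -> x \in ends e -> x \in vset A.
Proof. by move=> eA xe; apply/vsetP; exists e. Qed.

Lemma vsetS A B : A `<=` B -> vset A `<=` vset B.
Proof.
move=> AB; apply/fsubsetP => x /vsetP[e eA xe].
exact: mem_vset (fsubsetP AB _ eA) xe.
Qed.

Lemma spath_vset u v A W x : spath u v A W -> u != v ->
  (x \in W) = (x \in vset A).
Proof.
move=> p uv; apply/idP/idP; last by case/vsetP => e eA; apply: spath_ends p eA.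
elim: p uv => [a|a b c f C Y fe bc IH aY] ac; first by rewrite eqxx in ac.
rewrite !inE => /orP[/eqP->|xY].
  by apply: (@mem_vset _ f); rewrite ?fe !inE eqxx.
have [bc'|bc'] := eqVneq b c; last first.
  apply: (fsubsetP (vsetS _)) (IH bc' xY); exact: fsubsetU1.
move: xY; subst c; inversion bc as [|? ? ? ? ? ? ? q nq]; subst.
  by rewrite inE => /eqP->; apply: (@mem_vset _ f); rewrite ?fe !inE eqxx ?orbT.
by rewrite (spath_end q) in nq.
Qed.

Lemma spath_sub_vset u v A W B : spath u v A W -> A `<=` B -> u \in vset B ->
  W `<=` vset B.
Proof.
move=> p AB uB; apply/fsubsetP => x xW.
have [uv|uv] := eqVneq u v; last first.
  by apply: (fsubsetP (vsetS AB)); rewrite -(spath_vset x p uv).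
subst v; move: xW; inversion p as [|? ? ? ? ? ? ? q nq]; subst.
  by rewrite inE => /eqP->.
by rewrite (spath_end q) in nq.
Qed.

Definition reach A u v := exists B W, spath u v B W /\ B `<=` A.

Lemma reach_refl A u : reach A u u.
Proof. by exists fset0, [fset u]; split; [exact: spath_nil|exact: fsub0set]. Qed.

Lemma reach_sym A u v : reach A u v -> reach A v u.
Proof. by move=> [B [W [p BA]]]; exists B, W; split=> //; apply: spath_rev. Qed.

Lemma reach_edge A e u v : e \in A -> u \in ends e -> v \in ends e ->
  reach A u v.
Proof.
move=> eA ue; have [w wu ee] := ends_pair ue; rewrite ee !inE.
case/orP=> /eqP->; first exact: reach_refl.
by exists [fset e], [fset u; w]; split; [exact: spath_edge|rewrite fsub1set].
Qed.

(** Concatenation may destroy simplicity; the first path is left at its first vertex on the second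
    one. *)
Lemma reach_trans A u v w : reach A u v -> reach A v w -> reach A u w.
Proof.
move=> [B [W [p BA]]] [C [X [q CA]]].
have [y [A1 [W1 [A2 [W2 [[yX p1 p2] [BE WE d1 d2]]]]]]] :=
  spath_first (S := mem X) p (spath_end p) (spath_start q).
have [C1 [X1 [C2 [X2 [q1 q2 CE XE d3]]]]] := spath_split q yX.
exists (A1 `|` C2), (W1 `|` X2); split.
  apply: (spath_cat p1 q2) => z zW zX; apply: d2 => //.
  by rewrite /= XE inE zX orbT.
rewrite fsubUset; apply/andP; split.
  by apply: fsubset_trans BA; rewrite BE fsubsetUl.
by apply: fsubset_trans CA; rewrite CE fsubsetUr.
Qed.

(** * Degrees and parity *)

Definition incident A x := [fset e in A | x \in ends e].
Definition deg A x := #|` incident A x|.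

Lemma deg_gt0 A x : (0 < deg A x) = (x \in vset A).
Proof.
rewrite /deg cardfs_gt0; apply/fset0Pn/vsetP => [[e]|[e eA xe]].
  by rewrite !inE => /andP[]; exists e.
by exists e; rewrite !inE eA xe.
Qed.

Lemma deg0 x : deg fset0 x = 0.
Proof. by apply/eqP; rewrite cardfs_eq0 -fsubset0 fset_sub. Qed.

Lemma degS A B x : A `<=` B -> deg A x <= deg B x.
Proof.
move=> AB; apply: fsubset_leq_card; apply/fsubsetP => e; rewrite !inE.
by case/andP => /(fsubsetP AB) -> ->.
Qed.

Lemma degU1 A e x : e \notin A -> deg (e |` A) x = (x \in ends e) + deg A x.
Proof.
move=> eA; rewrite /deg.
suff -> : incident (e |` A) x =
    (if x \in ends e then e |` incident A x else incident A x).
  by case: ifP => // xe; rewrite cardfsU1 !inE (negPf eA).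
apply/fsetP => f; rewrite !inE; case: ifP => xe; rewrite !inE.
  by case: eqP => [->|//]; rewrite xe.
by case: eqP => [->|//]; rewrite xe (negPf eA).
Qed.

Lemma degD1 A e x : e \in A -> deg A x = (x \in ends e) + deg (A `\ e) x.
Proof. by move=> eA; rewrite -{1}(fsetD1K eA) degU1// !inE eqxx. Qed.

Lemma deg_eq A B x : (forall e, x \in ends e -> (e \in A) = (e \in B)) ->
  deg A x = deg B x.
Proof.
move=> AB; congr (#|` _|); apply/fsetP => e; rewrite !inE andbC [RHS]andbC.
by case: (boolP (x \in ends e)) => //= /AB.
Qed.

Lemma odd_fsymdiff (T : choiceType) (A B : {fset T}) :
  odd #|` fsymdiff A B| = odd #|` A| (+) odd #|` B|.
Proof.
have dis : (A `\` B) `&` (B `\` A) = fset0.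
  by apply/fsetP => x; rewrite !inE; case: (x \in A); rewrite ?andbF.
have := cardfsID B A; have := cardfsID A B; rewrite /fsymdiff (fsetIC B A).
rewrite cardfsU dis cardfs0 subn0 => <- <-; rewrite !oddD.
by case: (odd #|` A `&` B|); case: (odd #|` A `\` B|); case: (odd #|` B `\` A|).
Qed.

Lemma odd_deg_fsymdiff A B x :
  odd (deg (fsymdiff A B) x) = odd (deg A x) (+) odd (deg B x).
Proof.
rewrite /deg -odd_fsymdiff; congr (odd #|` _|); apply/fsetP => e.
by rewrite in_fsymdiff !inE; case: (e \in A); case: (e \in B);
  case: (x \in ends e).
Qed.

Lemma spath_odd u v A W x : spath u v A W ->
  odd (deg A x) = (x == u) (+) (x == v).
Proof.
elim=> [y|a b c f C Y fe bc IH aY].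
  by rewrite addbb deg0.
have fC : f \notin C.
  by apply: contra aY => fB; apply: (spath_ends bc fB); rewrite fe !inE eqxx.
rewrite degU1// oddD IH fe !inE; have := ends_neq fe.
case: (eqVneq x a) => [->|_ _] /=; last by case: (x == b); case: (x == c).
by case: (a == b) => //= _; case: (a == c).
Qed.

Lemma spath_deg_start u v A W : spath u v A W -> deg A u <= 1.
Proof.
case=> [y|a b c f C Y fe bc aY].
  by rewrite deg0.
have aC : a \notin vset C.
  by apply: contra aY => /vsetP[e eC]; apply: spath_ends bc eC.
have fC : f \notin C.
  by apply: contra aC => fC; apply: mem_vset fC _; rewrite fe !inE eqxx.
by rewrite degU1//; move: aC; rewrite -deg_gt0; case: (deg C a); case: (_ \in _).
Qed.

Lemma spath_deg u v A W x : spath u v A W -> deg A x <= 2.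
Proof.
elim=> [y|a b c f C Y fe bc IH aY].
  by rewrite deg0.
have aC : a \notin vset C.
  by apply: contra aY => /vsetP[e eC]; apply: spath_ends bc eC.
have fC : f \notin C.
  by apply: contra aC => fC; apply: mem_vset fC _; rewrite fe !inE eqxx.
rewrite degU1// fe !inE; case: (eqVneq x a) => [->|_].
  by move: aC; rewrite -deg_gt0; case: (deg C a).
case: (eqVneq x b) => [->|//]; exact: spath_deg_start bc.
Qed.

Lemma fsub_U1_notin (T : choiceType) (A B : {fset T}) t :
  A `<=` t |` B -> t \notin A -> A `<=` B.
Proof.
move=> AB tA; apply/fsubsetP => x xA; move: (fsubsetP AB _ xA); rewrite !inE.
by case: eqP => // xt; move: tA; rewrite -xt xA.
Qed.

(** The start of a path has degree at most one, so an even subset misses the first edge, and the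
    next vertex becomes the start. *)
Lemma spath_acyclic u v A W B : spath u v A W -> B `<=` A ->
  (forall x, ~~ odd (deg B x)) -> B = fset0.
Proof.
elim=> [y|a b c f C Y fe bc IH aY] BA ev.
  by apply/eqP; rewrite -fsubset0.
apply: IH => //; apply: (fsub_U1_notin BA); apply/negP => fB.
have := ev a; have := degS a BA.
have := spath_deg_start (spath_cons fe bc aY).
have : 0 < deg B a by rewrite deg_gt0; apply: mem_vset fB _; rewrite fe !inE eqxx.
by case: (deg B a) => [|[|n]] //= _; case: deg => [|[|]].
Qed.

(** Deleting an edge at [u] moves the odd vertex to the other end of that edge. The path found from
    there is cut at [u] if it returns to [u]. *)
Lemma odd_reach A u v : u != v ->
  (forall x, odd (deg A x) = (x == u) (+) (x == v)) -> reach A u v.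
Proof.
have [n] := ubnP #|` A|; elim: n A u => // n IH A u An uv odA.
have : 0 < deg A u.
  by have := odA u; rewrite eqxx (negPf uv); case: deg.
rewrite deg_gt0 => /vsetP[e eA ue]; have [w wu ee] := ends_pair ue.
have [wv|wv] := eqVneq w v.
  by apply: (reach_edge eA ue); rewrite ee -wv !inE eqxx orbT.
have /(_ _ _ _)[||x|B [X [p BA]]] := IH (A `\ e) w => //.
- by move: An; rewrite (cardfsD1 e) eA.
- have := odA x; rewrite (degD1 _ eA) oddD ee !inE.
  have := wu; case: (eqVneq x u) => [->|_] /=; rewrite ?(negPf uv).
    by rewrite eq_sym => /negPf->; case: odd.
  by case: (x == w); case: (x == v) => //=; case: odd.
have BA' : B `<=` A by apply: fsubset_trans BA (fsubD1set _ _).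
have [uX|uX] := boolP (u \in X).
  have [A1 [W1 [A2 [W2 [_ p2 BE _ _]]]]] := spath_split p uX.
  exists A2, W2; split=> //; apply: fsubset_trans BA'.
  by rewrite BE fsubsetUr.
exists (e |` B), (u |` X); split; first exact: spath_cons ee p uX.
by rewrite fsubUset fsub1set eA.
Qed.

(** * Comparison with walks and cycles *)

Lemma in_fset_seq (T : choiceType) (s : seq T) (t : T) :
  (t \in [fset y in s]) = (t \in s).
Proof. by rewrite in_fset. Qed.

Lemma walk_spath u es vs : walk u es vs -> uniq (u :: vs) ->
  spath u (last u vs) [fset e in es] [fset x in u :: vs].
Proof.
elim: es u vs => [|e es IH] u [|w vs] //=.
  move=> _ _; have -> : [fset e in [::]] = fset0 :> {fset E}.
    by apply/fsetP => e; rewrite !inE.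
  have -> : [fset x in [:: u]] = [fset u]; last exact: spath_nil.
  by apply/fsetP => x; rewrite !inE ?orbF.
move=> /andP[/eqP ee wk] /andP[uvs un].
have -> : [fset f in e :: es] = e |` [fset f in es].
  by apply/fsetP => f; rewrite !inE.
have -> : [fset x in [:: u, w & vs]] = u |` [fset x in w :: vs].
  by apply/fsetP => x; rewrite !inE.
by apply: spath_cons ee (IH _ _ wk un) _; rewrite in_fset_seq.
Qed.

Lemma spath_walk u v A W : spath u v A W ->
  exists es vs, [/\ walk u es vs, last u vs = v, uniq (u :: vs), uniq es
    & A = [fset e in es] /\ W = [fset x in u :: vs]].
Proof.
elim=> [x|a b c f B X fe bX [es [vs [wk la un une [BE XE]]]] aX].
  by exists [::], [::]; split=> //; split; apply/fsetP => y; rewrite !inE ?orbF.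
exists (f :: es), (b :: vs); split=> //=.
- by rewrite fe eqxx wk.
- by move: aX; rewrite XE in_fset_seq => ->.
- rewrite une andbT; apply: contra aX => fes.
  by apply: (spath_ends bX (e := f)); rewrite ?BE ?in_fset_seq// fe !inE eqxx.
- by rewrite BE XE; split; apply/fsetP => y; rewrite !inE ?in_fset_seq ?inE.
Qed.

Lemma simple_pathP u v A : is_simple_path u v A <-> exists W, spath u v A W.
Proof.
split=> [[es [vs [wk <- un ->]]]|[W /spath_walk[es [vs [wk la un _ [AE _]]]]]].
  by exists [fset x in u :: vs]; apply: walk_spath.
by exists es, vs.
Qed.

Lemma walk_cat u es vs es' vs' : walk u es vs ->
  walk u (es ++ es') (vs ++ vs') = walk (last u vs) es' vs'.
Proof.
by elim: es u vs => [|e es IH] u [|w vs] //= /andP[-> /IH ->].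
Qed.

Lemma spath_cycle u v A B W X : u != v -> spath u v A W -> spath u v B X ->
  (forall z, z \in W -> z \in X -> z = u \/ z = v) -> A `&` B = fset0 ->
  is_cycle (A `|` B).
Proof.
move=> uv /spath_walk[es [vs [wk la un une [AE WE]]]] /spath_rev/spath_walk.
move=> [es' [vs' [wk' la' un' une' [BE XE]]]] dis AB.
exists u, (es ++ es'), (vs ++ vs'); split.
- by rewrite (walk_cat _ _ wk) la.
- by rewrite last_cat la.
- have := un; have := un'; rewrite lastI rcons_uniq la' => /andP[ub ub'].
  rewrite lastI rcons_uniq la => /andP[vb vb'].
  rewrite belast_cat la cat_uniq ub' vb' andbT /=; apply/hasPn => z zb'.
  apply/negP => zb.
  have [] := dis z; rewrite ?WE ?XE ?in_fset_seq.
  - by rewrite lastI mem_rcons inE zb orbT.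
  - by rewrite lastI mem_rcons inE zb' orbT.
  - by move=> zu; move: ub; rewrite -zu zb'.
  - by move=> zv; move: vb; rewrite -zv zb.
- rewrite cat_uniq une une' andbT; apply/hasPn => e ee'; apply/negP => ee.
  have : e \in A `&` B by rewrite AE BE inE !in_fset_seq ee.
  by rewrite AB inE.
- by apply/fsetP => e; rewrite AE BE inE !in_fset_seq mem_cat.
Qed.

(** * Isometric cycles and subdivisions of K4 *)

Lemma spath_nonempty u v A W : u != v -> spath u v A W -> 0 < #|` A|.
Proof.
move=> uv p; rewrite cardfs_gt0; apply/eqP => A0.
have := spath_vset u p uv; rewrite (spath_start p) A0.
by move/esym/vsetP => [e]; rewrite inE.
Qed.

(* The arcs [b] and [c] diverge on the cycle [b `|` c], so transitivity of
   [sim] through [a] bounds the length of that cycle. *)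
Lemma cycle_isometric (ccG : controlled_cycles G) u v a Wa b Wb c Wc : u != v ->
  spath u v a Wa -> spath u v b Wb -> spath u v c Wc ->
  (forall z, z \in Wb -> z \in Wc -> z = u \/ z = v) -> b `&` c = fset0 ->
  minn #|` b| #|` c| <= #|` a|.
Proof.
move=> uv pa pb pc dis bc.
have cyc := spath_cycle uv pb pc dis bc.
have mk A W (p : spath u v A W) : exists s : simple_path u v, edges s = A.
  have sA : is_simple_path u v A by apply/simple_pathP; exists W.
  by exists (exist _ A (mem_set sA)).
have [sa saE] := mk _ _ pa; have [sb sbE] := mk _ _ pb.
have [sc scE] := mk _ _ pc.
(* Two paths diverge only on cycles contained in their union, so neither [a], [b] nor [a], [c]
   diverge on a cycle longer than [n]. The bound [#|b| + #|c| <= n] is the desired inequality. *)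
pose n := maxn (#|` a| + #|` b|) (#|` a| + #|` c|).
have short (s t : simple_path u v) :
    #|` edges s| + #|` edges t| <= n -> sim n s t.
  move=> st C _ nC [_ _ _ CE]; move: nC; rewrite ltnNge => /negP; apply.
  apply: leq_trans st; apply: (@leq_trans #|` edges s `|` edges t|).
    apply: fsubset_leq_card; rewrite CE; apply/fsubsetP => e; rewrite !inE.
    by case/orP => /andP[->]; rewrite ?orbT.
  by rewrite cardfsU leq_subr.
have [_ _ tr] := ccG n u v.
have ba : sim n sb sa by apply: short; rewrite saE sbE addnC leq_maxl.
have ac : sim n sa sc by apply: short; rewrite saE scE leq_maxr.
have := tr _ _ _ ba ac _ cyc.
have [|nC _] := ltnP n #|` b `|` c|; last first.
  by move: nC; rewrite cardfsU bc cardfs0 subn0 /n; lia.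
move=> _ /(_ isT) []; rewrite /diverge sbE scE.
have bI : b `&` (b `|` c) = b by rewrite fsetKU.
have cI : c `&` (b `|` c) = c by rewrite fsetUC fsetKU.
rewrite bI cI; split=> //.
- by move=> b0; have := spath_nonempty uv pb; rewrite b0 cardfs0.
- by move=> c0; have := spath_nonempty uv pc; rewrite c0 cardfs0.
- by rewrite -fsetI_eq0 bc.
Qed.

Lemma spath_edge_disjoint u v A W u' v' B X k :
  spath u v A W -> spath u' v' B X ->
  (forall z, z \in W -> z \in X -> z = k) -> A `&` B = fset0.
Proof.
move=> p q dis; apply/eqP; rewrite -fsubset0; apply/fsubsetP => e.
rewrite inE => /andP[eA eB].
have [x xe] := ends_inhabited e.
have [y yx ee] := ends_pair xe.
have ye : y \in ends e by rewrite ee !inE eqxx orbT.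
have := dis _ (spath_ends p eA ye) (spath_ends q eB ye).
have := dis _ (spath_ends p eA xe) (spath_ends q eB xe).
by move=> xk yk; move: yx; rewrite xk yk eqxx.
Qed.

(** The cycle that avoids two opposite arcs of a subdivided K4 comes as four arcs meeting at
    consecutive corners, with [B] as a chord. *)
Lemma cycle4_isometric (ccG : controlled_cycles G) i j k l
    A1 W1 A2 W2 A3 W3 A4 W4 B X : i != j ->
  spath i k A1 W1 -> spath k j A2 W2 -> spath i l A3 W3 -> spath l j A4 W4 ->
  spath i j B X ->
  (forall z, z \in W1 -> z \in W2 -> z = k) ->
  (forall z, z \in W3 -> z \in W4 -> z = l) ->
  (forall z, z \in W1 -> z \in W3 -> z = i) ->
  (forall z, z \in W2 -> z \in W4 -> z = j) ->
  (forall z, z \in W1 -> z \in W4 -> False) ->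
  (forall z, z \in W2 -> z \in W3 -> False) ->
  minn (#|` A1| + #|` A2|) (#|` A3| + #|` A4|) <= #|` B|.
Proof.
move=> ij p1 p2 p3 p4 p d12 d34 d13 d24 d14 d23.
have e12 := spath_edge_disjoint p1 p2 d12.
have e34 := spath_edge_disjoint p3 p4 d34.
have e13 := spath_edge_disjoint p1 p3 d13.
have e24 := spath_edge_disjoint p2 p4 d24.
have e14 : A1 `&` A4 = fset0.
  by apply: (spath_edge_disjoint p1 p4 (k := i)) => z z1 /(d14 _ z1).
have e23 : A2 `&` A3 = fset0.
  by apply: (spath_edge_disjoint p2 p3 (k := i)) => z z1 /(d23 _ z1).
have := cycle_isometric ccG ij p (spath_cat p1 p2 d12) (spath_cat p3 p4 d34).
rewrite !cardfsU e12 e34 cardfs0 !subn0; apply.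
  move=> z; rewrite !inE => /orP[z12|z12] /orP[z34|z34].
  - by left; apply: d13.
  - by case: (d14 z).
  - by case: (d23 z).
  - by right; apply: d24.
by rewrite fsetIUl !fsetIUr e13 e14 e23 e24 !fsetU0.
Qed.

(* Each of the six arcs of this subdivision of K4 is a chord of the Hamiltonian
   cycle avoiding it and the opposite arc; a shortest one violates
   [cycle4_isometric]. *)
Lemma no_subdivided_K4 (ccG : controlled_cycles G) b c x y
    P1 U1 Q1 Y1 P2 U2 Q2 Y2 R U3 S Z : b != c ->
  spath b x P1 U1 -> spath x c Q1 Y1 -> spath b y P2 U2 -> spath y c Q2 Y2 ->
  spath b c R U3 -> spath x y S Z ->
  (forall z, z \in U1 -> z \in Y1 -> z = x) ->
  (forall z, z \in U2 -> z \in Y2 -> z = y) ->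
  (forall z, z \in U1 -> z \in U2 -> z = b) ->
  (forall z, z \in Y1 -> z \in Y2 -> z = c) ->
  (forall z, z \in U1 -> z \in Y2 -> False) ->
  (forall z, z \in U2 -> z \in Y1 -> False) ->
  (forall z, z \in U1 -> z \in U3 -> z = b) ->
  (forall z, z \in U2 -> z \in U3 -> z = b) ->
  (forall z, z \in Y1 -> z \in U3 -> z = c) ->
  (forall z, z \in Y2 -> z \in U3 -> z = c) ->
  (forall z, z \in U1 -> z \in Z -> z = x) ->
  (forall z, z \in Y1 -> z \in Z -> z = x) ->
  (forall z, z \in U2 -> z \in Z -> z = y) ->
  (forall z, z \in Y2 -> z \in Z -> z = y) ->
  (forall z, z \in U3 -> z \in Z -> False) -> False.
Proof.
move=> bc p1 q1 p2 q2 r s d1 d2 d3 d4 d5 d6 d7 d8 d9 d10 d11 d12 d13 d14 d15.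
have xb : b != x.
  by apply/eqP => E; apply: (d15 b); rewrite ?(spath_start r)// E (spath_start s).
have xc : x != c.
  by apply/eqP => E; apply: (d15 c); rewrite ?(spath_end r)// -E (spath_start s).
have yb : b != y.
  by apply/eqP => E; apply: (d15 b); rewrite ?(spath_start r)// E (spath_end s).
have yc : y != c.
  by apply/eqP => E; apply: (d15 c); rewrite ?(spath_end r)// -E (spath_end s).
have xy : x != y.
  by apply/eqP => E; apply: (d5 x); rewrite ?(spath_end p1)// E (spath_start q2).
have n1 := spath_nonempty xb p1; have n2 := spath_nonempty xc q1.
have n3 := spath_nonempty yb p2; have n4 := spath_nonempty yc q2.
have n5 := spath_nonempty bc r; have n6 := spath_nonempty xy s.
have p1' := spath_rev p1; have q1' := spath_rev q1.
have p2' := spath_rev p2; have q2' := spath_rev q2; have s' := spath_rev s.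
have i1 := cycle4_isometric ccG bc p1 q1 p2 q2 r.
have i2 := cycle4_isometric ccG xy q1 q2' p1' p2 s.
have i3 := cycle4_isometric ccG xb r q1' p2 s' p1.
have i4 := cycle4_isometric ccG yc s' q1 p2' r q2.
have i5 := cycle4_isometric ccG yb r q2' p1 s p2.
have i6 := cycle4_isometric ccG xc s q2 p1' r q1.
have {}i1 := i1 d1 d2 d3 d4 d5 (fun z a b => d6 z b a).
have {}i2 : minn (#|` Q1| + #|` Q2|) (#|` P1| + #|` P2|) <= #|` S|.
  by apply: i2; eauto.
have {}i3 : minn (#|` R| + #|` Q1|) (#|` P2| + #|` S|) <= #|` P1|.
  by apply: i3; eauto.
have {}i4 : minn (#|` S| + #|` Q1|) (#|` P2| + #|` R|) <= #|` Q2|.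
  by apply: i4; eauto.
have {}i5 : minn (#|` R| + #|` Q2|) (#|` P1| + #|` S|) <= #|` P2|.
  by apply: i5; eauto.
have {}i6 : minn (#|` S| + #|` Q2|) (#|` P1| + #|` R|) <= #|` Q1|.
  by apply: i6; eauto.
lia.
Qed.

(** Trimmed to its first arrival on the other two arcs and its last departure from the first one,
    the bridge completes the theta to a subdivided K4. *)
Lemma theta_no_bridge (ccG : controlled_cycles G) b c
    A1 W1 A2 W2 A3 W3 x0 y0 S Z : b != c ->
  spath b c A1 W1 -> spath b c A2 W2 -> spath b c A3 W3 ->
  (forall z, z \in W1 -> z \in W2 -> z = b \/ z = c) ->
  (forall z, z \in W1 -> z \in W3 -> z = b \/ z = c) ->
  (forall z, z \in W2 -> z \in W3 -> z = b \/ z = c) ->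
  spath x0 y0 S Z -> x0 \in W1 -> y0 \in W2 `|` W3 ->
  b \notin Z -> c \notin Z -> False.
Proof.
move=> bc p1 p2 p3 d12 d13 d23 s x0W y0W bZ cZ.
have [y [S1 [Z1 [_ [Z1' [[yW s1 _] [_ ZE _ h1]]]]]]] :=
  spath_first (S := mem (W2 `|` W3)) s (spath_end s) y0W.
have [x [S2 [Z2 [_ [Z2' [[xW s2 _] [_ Z1E _ h2]]]]]]] :=
  spath_first (S := mem W1) (spath_rev s1) (spath_start s1) x0W.
have Z21 z : z \in Z2 -> z \in Z1 by move=> zZ; rewrite Z1E inE zZ.
have Z1Z z : z \in Z1 -> z \in Z by move=> zZ; rewrite ZE inE zZ.
have bc_notin z : z = b \/ z = c -> z \in Z2 -> False.
  by case=> -> /Z21/Z1Z zZ; [rewrite zZ in bZ|rewrite zZ in cZ].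
rewrite /= in xW yW.
wlog yW2 : A2 W2 A3 W3 p2 p3 d12 d13 d23 {y0W} yW h1 / y \in W2.
  move=> wl; have := yW; rewrite inE => /orP[y2|y3]; first exact: (wl A2 W2 A3 W3).
  apply: (wl A3 W3 A2 W2) => //; rewrite 1?fsetUC// => z z2 z3; exact: d23.
have yZ := spath_start s2; have xZ := spath_end s2.
have [P1 [U1 [Q1 [Y1 [pp1 qq1 _ W1E e1]]]]] := spath_split p1 xW.
have [P2 [U2 [Q2 [Y2 [pp2 qq2 _ W2E e2]]]]] := spath_split p2 yW2.
have U1W z : z \in U1 -> z \in W1 by move=> h; rewrite W1E inE h.
have Y1W z : z \in Y1 -> z \in W1 by move=> h; rewrite W1E inE h orbT.
have U2W z : z \in U2 -> z \in W2 by move=> h; rewrite W2E inE h.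
have Y2W z : z \in Y2 -> z \in W2 by move=> h; rewrite W2E inE h orbT.
have cU1 : c \notin U1.
  apply/negP => h; apply: (bc_notin c); first by right.
  by rewrite (e1 _ h (spath_end qq1)).
have cU2 : c \notin U2.
  apply/negP => h; apply: (bc_notin c); first by right.
  by rewrite (e2 _ h (spath_end qq2)).
have bY1 : b \notin Y1.
  apply/negP => h; apply: (bc_notin b); first by left.
  by rewrite (e1 _ (spath_start pp1) h).
have bY2 : b \notin Y2.
  apply/negP => h; apply: (bc_notin b); first by left.
  by rewrite (e2 _ (spath_start pp2) h).
have inU X z : (z = b \/ z = c) -> z \in X -> c \notin X -> z = b.
  by case=> // -> ->.
have inY X z : (z = b \/ z = c) -> z \in X -> b \notin X -> z = c.
  by case=> // -> ->.
apply: (no_subdivided_K4 ccG bc pp1 qq1 pp2 qq2 p3 (spath_rev s2)) => //.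
- by move=> z h1' h2'; apply: (inU U1) => //; apply: d12; auto.
- by move=> z h1' h2'; apply: (inY Y1) => //; apply: d12; auto.
- move=> z h1' h2'; have zbc : z = b \/ z = c by apply: d12; auto.
  by move: bY2; rewrite -(inU U1 z zbc h1' cU1) h2'.
- move=> z h1' h2'; have zbc : z = b \/ z = c by apply: d12; auto.
  by move: bY1; rewrite -(inU U2 z zbc h1' cU2) h2'.
- by move=> z h1' h2'; apply: (inU U1) => //; apply: d13; auto.
- by move=> z h1' h2'; apply: (inU U2) => //; apply: d23; auto.
- by move=> z h1' h2'; apply: (inY Y1) => //; apply: d13; auto.
- by move=> z h1' h2'; apply: (inY Y2) => //; apply: d23; auto.
- by move=> z h1' h2'; apply: h2 => //; apply: U1W.
- by move=> z h1' h2'; apply: h2 => //; apply: Y1W.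
- by move=> z h1' h2'; apply: h1; [apply: Z21|rewrite /= inE U2W].
- by move=> z h1' h2'; apply: h1; [apply: Z21|rewrite /= inE Y2W].
- move=> z h1' h2'; have zy : z = y by apply: h1; [apply: Z21|rewrite /= inE h1' orbT].
  by apply: (bc_notin y) => //; apply: d23 => //; rewrite -zy.
Qed.

(** * Tripods over an even set, and the splitting of a path *)

Lemma spath_loop u A W : spath u u A W -> A = fset0 /\ W = [fset u].
Proof.
move=> p; inversion p as [|? w ? ? B X ? q nq]; subst; first by [].
by rewrite (spath_end q) in nq.
Qed.

(** From [x] the path is followed in whichever direction leads to [y], up to the first vertex in
    [S]. *)
Lemma spath_toward (S : pred V) u v A W x y : spath u v A W ->
  x \in W -> y \in W -> S y ->
  exists z B X, [/\ spath x z B X, S z, B `<=` A, X `<=` W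
    & forall t, t \in X -> S t -> t = z].
Proof.
move=> p xW yW Sy.
have [A1 [W1 [A2 [W2 [p1 p2 AE WE _]]]]] := spath_split p xW.
have [q [B [X [xB yX BA XW]]]] : exists q B X,
    [/\ spath x q B X, y \in X, B `<=` A & X `<=` W].
  move: yW; rewrite WE inE => /orP[y1|y2].
    exists u, A1, W1; split=> //; first exact: spath_rev.
      by rewrite AE fsubsetUl.
    by rewrite fsubsetUl.
  exists v, A2, W2; split=> //; first by rewrite AE fsubsetUr.
  by rewrite fsubsetUr.
have [z [B1 [X1 [B2 [X2 [[Sz pz _] [BE XE _ h]]]]]]] := spath_first xB yX Sy.
exists z, B1, X1; split=> //.
  by apply: fsubset_trans BA; rewrite BE fsubsetUl.
by apply: fsubset_trans XW; rewrite XE fsubsetUl.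
Qed.

Lemma deg_fsetD A B x : B `<=` A -> deg A x = deg B x + deg (A `\` B) x.
Proof.
move=> BA; have := cardfsID (incident B x) (incident A x); rewrite /deg.
have -> : incident A x `&` incident B x = incident B x.
  apply/fsetP => e; rewrite !inE; case: (boolP (e \in B)) => [/(fsubsetP BA) ->|].
    by rewrite andbb.
  by rewrite andbF.
have -> : incident A x `\` incident B x = incident (A `\` B) x.
  apply/fsetP => e; rewrite !inE.
  by case: (e \in A); case: (e \in B); case: (x \in ends e).
by move=> ->.
Qed.

(** The two distinct ends of a common edge would both be [t]. *)
Lemma edge_meets_once A B X t : (forall e x, e \in A -> x \in ends e -> x \in X) ->
  (forall z, z \in X -> z \in vset B -> z = t) -> A `&` B = fset0.
Proof.
move=> AX h; apply/eqP; rewrite -fsubset0; apply/fsubsetP => e.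
rewrite inE => /andP[eA eB].
have [x xe] := ends_inhabited e.
have [y yx ee] := ends_pair xe.
have ye : y \in ends e by rewrite ee !inE eqxx orbT.
have := h y (AX _ _ eA ye) (mem_vset eB ye).
have := h x (AX _ _ eA xe) (mem_vset eB xe).
by move=> xt yt; move: yx; rewrite xt yt eqxx.
Qed.

Definition connected_set A :=
  forall x y, x \in vset A -> y \in vset A -> reach A x y.

Definition even_set A := forall x, ~~ odd (deg A x).

(* By parity each leg at [c] has a second edge of [L] at [c] in its component
   of [L - c], so if no path of [L - c] joined two legs then [c] would have
   degree at least 6, or at least 4 when [c] is one of the feet. *)
Lemma no_double_tripod (ccG : controlled_cycles G) (L : {fset E}) b c
    (t : 'I_3 -> V) (A J : 'I_3 -> {fset E}) (W Y : 'I_3 -> {fset V}) :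
  even_set L -> (forall x, deg L x <= 4) -> (forall i, deg L (t i) <= 2) ->
  injective t -> (forall i, t i \in vset L) -> b \notin vset L ->
  (forall i, spath b (t i) (A i) (W i)) ->
  (forall i j, i != j -> forall z, z \in W i -> z \in W j -> z = b) ->
  (forall i z, z \in W i -> z \in vset L -> z = t i) ->
  (forall i, spath (t i) c (J i) (Y i)) -> (forall i, J i `<=` L) ->
  (forall i j, i != j -> forall z, z \in Y i -> z \in Y j -> z = c) -> False.
Proof.
move=> Lev L4 L2 tinj tL bL pA dW WL pJ JL dY.
have YL i z : z \in Y i -> z \in vset L.
  by move=> zY; apply: (fsubsetP (spath_sub_vset (pJ i) (JL i) (tL i))).
have cL : c \in vset L by apply: (YL ord0); apply: spath_end (pJ _).
have bc : b != c by apply: contraNneq bL => ->.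
have pF i : spath b c (A i `|` J i) (W i `|` Y i).
  by apply: (spath_cat (pA i) (pJ i)) => z zW /YL; apply: WL.
have dF i j : i != j -> forall z, z \in W i `|` Y i -> z \in W j `|` Y j ->
    z = b \/ z = c.
  move=> ij z; rewrite !inE => /orP[zi|zi] /orP[zj|zj].
  - by left; apply: dW ij _ zi zj.
  - right; apply: (dY _ _ ij _ _ zj).
    by rewrite (WL _ _ zi (YL _ _ zj)) (spath_start (pJ i)).
  - right; apply: (dY _ _ ij _ zi).
    by rewrite (WL _ _ zj (YL _ _ zi)) (spath_start (pJ j)).
  - by right; apply: dY ij _ zi zj.
pose Lc := [fset e in L | c \notin ends e].
have LcL : Lc `<=` L by apply/fsubsetP => e; rewrite !inE => /andP[].
have cLc : c \notin vset Lc.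
  by apply/vsetP => -[e]; rewrite !inE => /andP[_ /negPf->].
(* [e] is an edge of the leg at [c] with other end [w]. By parity [L] without [e] still joins [w] to
   [c]; [f] is the edge by which that path enters [c]. *)
have spread i : t i != c -> exists w (I : {fset E}), [/\ w \in Y i, w != c,
    #|` I| = 2, I `<=` incident L c
    & forall h z, h \in I -> z \in ends h -> z != c -> reach Lc w z].
  move=> tic; have := spath_end (pJ i); rewrite (spath_vset c (pJ i) tic).
  case/vsetP => e eJ ce; have [w wc ee] := ends_pair ce.
  have eL := fsubsetP (JL i) _ eJ.
  have we : w \in ends e by rewrite ee !inE eqxx orbT.
  have [|C [X [p CL]]] := odd_reach (A := L `\ e) wc.
    move=> x; have := Lev x; rewrite (degD1 _ eL) oddD ee !inE.
    have := wc; case: (eqVneq x c) => [->|_] /=; last first.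
      by case: (x == w); case: (odd (deg _ _)).
    by rewrite eq_sym => /negPf->; case: (odd (deg _ _)).
  have := spath_end p; rewrite (spath_vset c p wc) => /vsetP[f fC cf].
  have [y yc fe] := ends_pair cf.
  have yf : y \in ends f by rewrite fe !inE eqxx orbT.
  have := fsubsetP CL _ fC; rewrite !inE => /andP[fne fL].
  exists w, [fset e; f]; split=> //.
  - exact: spath_ends (pJ i) eJ we.
  - by rewrite cardfs2 eq_sym fne.
  - by apply/fsubsetP => h; rewrite !inE => /orP[]/eqP->; rewrite ?eL ?fL.
  move=> h z; rewrite !inE => /orP[]/eqP->.
    rewrite ee !inE => /orP[]/eqP->; first by rewrite eqxx.
    by move=> _; apply: reach_refl.
  rewrite fe !inE => /orP[]/eqP->; first by rewrite eqxx.
  move=> _; have yX := spath_ends p fC yf.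
  have [C1 [X1 [C2 [X2 [p1 p2 CE XE d12]]]]] := spath_split p yX.
  exists C1, X1; split=> //; apply/fsubsetP => g gC; rewrite !inE.
  have := fsubsetP CL g; rewrite CE !inE gC => /(_ isT)/andP[_ ->] /=.
  apply/negP => cg; move: yc.
  by rewrite -(d12 c (spath_ends p1 gC cg) (spath_end p2)) eqxx.
(* The three paths from [b] through the feet to [c] form a theta, for which a path of [Lc] between
   two legs would be a bridge. *)
have bridge i j w w' : i != j -> w \in Y i -> w != c -> w' \in Y j ->
    reach Lc w w' -> False.
  move=> ij wY wc wY' [B [Z [p BL]]].
  have [k [ki kj]] : exists k : 'I_3, i != k /\ j != k.
    move: ij; case: i {wY} => [[|[|[|]]] //= ?]; case: j {wY'} => [[|[|[|]]] //= ?] _;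
    by [exists (inord 0); rewrite -!val_eqE /= inordK
       |exists (inord 1); rewrite -!val_eqE /= inordK
       |exists (inord 2); rewrite -!val_eqE /= inordK].
  have Zsub z : z \in Z -> z \in vset L /\ z != c.
    have [ww'|ww'] := eqVneq w w'.
      move: p; rewrite -ww' => /spath_loop[_ ->]; rewrite inE => /eqP->.
      by split=> //; apply: YL wY.
    rewrite (spath_vset z p ww') => /(fsubsetP (vsetS BL)) zL; split.
      exact: (fsubsetP (vsetS LcL)).
    by apply: contraNneq cLc => <-.
  apply: (theta_no_bridge ccG bc (pF i) (pF j) (pF k) (dF _ _ ij) (dF _ _ ki)
           (dF _ _ kj) p).
  - by rewrite inE wY orbT.
  - by rewrite !inE wY' orbT.
  - by apply: contra bL => /Zsub[].
  - by apply/negP => /Zsub[_]; rewrite eqxx.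
have apart i j w I w' I' : i != j -> w \in Y i -> w != c -> w' \in Y j ->
    w' != c -> I `<=` incident L c ->
    (forall h z, h \in I -> z \in ends h -> z != c -> reach Lc w z) ->
    (forall h z, h \in I' -> z \in ends h -> z != c -> reach Lc w' z) ->
    I `&` I' = fset0.
  move=> ij wY wc wY' wc' IL r r'; apply/eqP; rewrite -fsubset0.
  apply/fsubsetP => h; rewrite inE => /andP[hI hI']; exfalso.
  have := fsubsetP IL _ hI; rewrite !inE => /andP[_ /ends_pair[z zc he]].
  have zh : z \in ends h by rewrite he !inE eqxx orbT.
  apply: (bridge i j w w') => //.
  exact: reach_trans (r _ _ hI zh zc) (reach_sym (r' _ _ hI' zh zc)).
have two i j : i != j -> t i != c -> t j != c -> 4 <= deg L c.
  move=> ij /spread[w [I [wY wc I2 IL r]]] /spread[w' [I' [wY' wc' I2' IL' r']]].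
  have II' := apart _ _ _ _ _ _ ij wY wc wY' wc' IL r r'.
  apply: (@leq_trans #|` I `|` I'|).
    by rewrite cardfsU II' cardfs0 I2 I2'.
  by apply: fsubset_leq_card; rewrite fsubUset IL IL'.
pose i0 : 'I_3 := inord 0; pose i1 : 'I_3 := inord 1; pose i2 : 'I_3 := inord 2.
have n01 : i0 != i1 by rewrite -val_eqE /= !inordK.
have n02 : i0 != i2 by rewrite -val_eqE /= !inordK.
have n12 : i1 != i2 by rewrite -val_eqE /= !inordK.
have foot i j k : i != j -> i != k -> j != k -> t i = c -> False.
  move=> ij ik jk tic.
  have : 4 <= deg L c.
    by apply: (two j k) => //; rewrite -tic (inj_eq tinj) // eq_sym.
  by rewrite -tic => h; have := leq_trans h (L2 i).
have t0 : t i0 != c by apply/eqP/(foot i0 i1 i2).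
have t1 : t i1 != c by apply/eqP/(foot i1 i0 i2); rewrite // eq_sym.
have t2 : t i2 != c by apply/eqP/(foot i2 i0 i1); rewrite // eq_sym.
have [w0 [I0 [wY0 wc0 c0 IL0 r0]]] := spread _ t0.
have [w1 [I1 [wY1 wc1 c1 IL1 r1]]] := spread _ t1.
have [w2 [I2 [wY2 wc2 c2 IL2 r2]]] := spread _ t2.
have e01 := apart _ _ _ _ _ _ n01 wY0 wc0 wY1 wc1 IL0 r0 r1.
have e02 := apart _ _ _ _ _ _ n02 wY0 wc0 wY2 wc2 IL0 r0 r2.
have e12 := apart _ _ _ _ _ _ n12 wY1 wc1 wY2 wc2 IL1 r1 r2.
have : 6 <= deg L c; last by move=> h; have := leq_trans h (L4 c).
apply: (@leq_trans #|` I0 `|` I1 `|` I2|).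
  rewrite cardfsU fsetIUl e02 e12 fsetU0 cardfs0 subn0 cardfsU e01 cardfs0 subn0.
  by rewrite c0 c1 c2.
by apply: fsubset_leq_card; rewrite !fsubUset IL0 IL1 IL2.
Qed.

Lemma deg_fsetIUD A B x : deg A x = deg (A `&` B) x + deg (A `\` B) x.
Proof.
rewrite (deg_fsetD x (fsubsetIl A B)); congr (_ + _); apply: deg_eq => e _.
by rewrite !inE; case: (e \in A); case: (e \in B).
Qed.

Lemma deg_fsymdiff A B x :
  deg (fsymdiff A B) x + (deg (A `&` B) x).*2 = deg A x + deg B x.
Proof.
rewrite (deg_fsetIUD A B) (deg_fsetIUD B A) (fsetIC B A).
have -> : deg (fsymdiff A B) x = deg (A `\` B) x + deg (B `\` A) x.
  rewrite (deg_fsetIUD (fsymdiff A B) A); congr (_ + _); apply: deg_eq => e _;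
    by rewrite inE in_fsymdiff !inE; case: (e \in A); case: (e \in B).
by rewrite -addnn; lia.
Qed.

Lemma deg_fsymdiff_le4 A B x : deg A x <= 2 -> deg B x <= 2 ->
  deg (fsymdiff A B) x <= 4.
Proof. by have := deg_fsymdiff A B x; lia. Qed.

Lemma deg_fsymdiff_le2 A B x : deg A x <= 2 -> deg B x <= 2 ->
  x \in vset (A `&` B) -> deg (fsymdiff A B) x <= 2.
Proof. by rewrite -deg_gt0; have := deg_fsymdiff A B x; lia. Qed.

Lemma even_deg_fsetD A B : B `<=` A ->
  (forall x, odd (deg B x) = odd (deg A x)) -> even_set (A `\` B).
Proof.
by move=> BA oAB x; have := oAB x; rewrite (deg_fsetD x BA) oddD;
  case: (odd (deg B x)); case: (odd _).
Qed.

Lemma fsymdiffK (T : choiceType) (A B : {fset T}) :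
  fsymdiff A (fsymdiff A B) = B.
Proof.
by apply/fsetP => x; rewrite !in_fsymdiff; case: (x \in A); case: (x \in B).
Qed.

Lemma spath_eq_of_sub u v A W P : spath u v A W -> P `<=` A ->
  (forall x, odd (deg P x) = (x == u) (+) (x == v)) -> P = A.
Proof.
move=> p PA oP; apply/eqP; rewrite eqEfsubset PA /= -fsetD_eq0; apply/eqP.
apply: (spath_acyclic p (fsubsetDl _ _)).
by apply: even_deg_fsetD => // x; rewrite oP (spath_odd x p).
Qed.

(** At a vertex of [P] the rest of [H] has even degree, and at most one is left, hence none. *)
Lemma spath_component_disjoint u v H P WP x : u != v ->
  (forall x, deg H x <= 2) -> (forall x, odd (deg H x) = (x == u) (+) (x == v)) ->
  spath u v P WP -> P `<=` H -> x \in WP -> x \notin vset (H `\` P).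
Proof.
move=> uv H2 Ho p PH; rewrite (spath_vset x p uv) -!deg_gt0.
have := even_deg_fsetD PH (fun y => etrans (spath_odd y p) (esym (Ho y))) x.
have := H2 x; rewrite (deg_fsetD x PH).
case: (deg P x) => [//|n]; case: (deg _ x) => [//|[//|m]].
by move=> h; exfalso; move: h; lia.
Qed.

Definition pick3 T (p q r : T) (i : 'I_3) :=
  if val i is 0 then p else if val i is 1 then q else r.

Lemma pick3E T (p q r : T) : (pick3 p q r (inord 0) = p) *
  (pick3 p q r (inord 1) = q) * (pick3 p q r (inord 2) = r).
Proof. by rewrite /pick3 /= !inordK. Qed.

Lemma ord3_ind (S : 'I_3 -> Prop) :
  S (inord 0) -> S (inord 1) -> S (inord 2) -> forall i, S i.
Proof.
move=> s0 s1 s2 i; case: i => [[|[|[|//]]] lti];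
  [move: s0|move: s1|move: s2]; congr S; apply: val_inj; rewrite /= inordK//.
Qed.

Lemma ord3_sym (R : 'I_3 -> 'I_3 -> Prop) : (forall i j, R i j -> R j i) ->
  R (inord 0) (inord 1) -> R (inord 0) (inord 2) -> R (inord 1) (inord 2) ->
  forall i j, i != j -> R i j.
Proof.
by move=> Rsym R01 R02 R12; apply: ord3_ind; apply: ord3_ind; rewrite ?eqxx//; auto.
Qed.

(* Otherwise a cycle of [H `\` P] through a vertex [b], and the connecting path
   followed by a piece of [P], yield three paths from [b] to the connected set
   [fsymdiff g H], contradicting [no_double_tripod]. *)
Lemma no_reconnection (ccG : controlled_cycles G) u v g Wg H P WP x0 y0 B X :
  u != v -> spath u v g Wg -> (forall x, deg H x <= 2) ->
  (forall x, odd (deg H x) = (x == u) (+) (x == v)) ->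
  connected_set (fsymdiff g H) -> spath u v P WP -> P `<=` H ->
  spath x0 y0 B X -> x0 \in vset (H `\` P) -> y0 \in WP ->
  (forall z, z \in X -> z \notin vset (fsymdiff g H)) -> False.
Proof.
move=> uv pg H2 Ho; set L := fsymdiff g H; set Q := H `\` P.
move=> Lc pP PH pB x0Q y0P XL.
have Qev : even_set Q.
  by apply: even_deg_fsetD => // x; rewrite Ho (spath_odd x pP).
have PQ x : x \in WP -> x \notin vset Q.
  exact: spath_component_disjoint uv H2 Ho pP PH.
have HLg e : e \in H -> e \notin L -> e \in g.
  by rewrite in_fsymdiff => ->; case: (e \in g).
have g2 x : deg g x <= 2 by exact: spath_deg pg.
have Lev : even_set L.
  by move=> x; rewrite odd_deg_fsymdiff Ho (spath_odd x pg) addbb.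
have L4 x : deg L x <= 4.
  exact: deg_fsymdiff_le4.
(* The connection is trimmed so that it meets [P] only at [b'] and [Q] only at [b]. *)
have [b' [B1 [X1 [_ [X1' [[b'P p1 _] [_ XE _ h1]]]]]]] :=
  spath_first (S := mem WP) pB (spath_end pB) y0P.
have [b [B2 [X2 [_ [X2' [[bQ p2 _] [_ X1E _ h2]]]]]]] :=
  spath_first (S := mem (vset Q)) (spath_rev p1) (spath_end (spath_rev p1)) x0Q.
rewrite /= in b'P bQ.
have X2L z : z \in X2 -> z \notin vset L.
  by move=> z2; apply: XL; rewrite XE X1E !inE z2.
have X2P z : z \in X2 -> z \in WP -> z = b'.
  by move=> z2; apply: h1; rewrite X1E inE z2.
have bL := X2L _ (spath_end p2).
(* Otherwise [P] lies in [g], hence equals [g]; then [Q] lies in [L], whereas [b] is off [L]. *)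
have [t tP tL] : exists2 t, t \in WP & t \in vset L.
  apply: contrapT => noL.
  have Pg : P `<=` g.
    apply/fsubsetP => e eP; apply: HLg; first exact: (fsubsetP PH).
    apply/negP => eL; apply: noL.
    have [x xe] := ends_inhabited e.
    by exists x; [exact: spath_ends pP eP xe|exact: mem_vset eL xe].
  have Pgg := spath_eq_of_sub pg Pg (fun x => spath_odd x pP).
  case/negP: bL; apply: (fsubsetP (vsetS _)) bQ.
  by apply/fsubsetP => e; rewrite in_fsymdiff !inE -Pgg => /andP[/negPf-> ->].
have [t3 [P3 [W3 [pt3 t3L P3P W3P h3]]]] :=
  spath_toward (S := mem (vset L)) pP b'P tP tL.
rewrite /= in t3L.
have [e eQ be] := vsetP _ _ bQ; have [w wb ee] := ends_pair be.
have we : w \in ends e by rewrite ee !inE eqxx orbT.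
have QH : Q `<=` H by apply: fsubsetDl.
have [|C [XC [pC CQ]]] := odd_reach (A := Q `\ e) wb.
  move=> x; have := Qev x; rewrite (degD1 _ eQ) oddD ee !inE.
  have := wb; case: (eqVneq x b) => [->|_] /=; last first.
    by case: (x == w); case: (odd (deg _ _)).
  by rewrite eq_sym => /negPf->; case: (odd (deg _ _)).
have CQ' : C `<=` Q by apply: fsubset_trans CQ (fsubD1set _ _).
have eC : e \notin C.
  by apply/negP => /(fsubsetP CQ); rewrite !inE eqxx.
have XCQ z : z \in XC -> z \in vset Q.
  by rewrite (spath_vset z pC wb) => /(fsubsetP (vsetS CQ')).
have once s : (forall z, z \in XC -> z \in vset L -> z = s) -> False.
  move=> hs; have cL : (e |` C) `&` L = fset0.
    apply: (edge_meets_once (X := XC) (t := s)) => // f x; rewrite !inE.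
    case/orP=> [/eqP->|fC xf]; last exact: spath_ends pC fC xf.
    rewrite ee !inE => /orP[]/eqP->; first exact: spath_end pC.
    exact: spath_start pC.
  have cg : e |` C `<=` g.
    apply/fsubsetP => f fC; apply: HLg.
      by apply: (fsubsetP QH); case/fset1UP: fC => [->//|/(fsubsetP CQ')].
    by apply/negP => fL; move/fsetP/(_ f): cL; rewrite in_fsetI fC fL.
  have cev x : ~~ odd (deg (e |` C) x).
    rewrite degU1// oddD (spath_odd x pC) ee !inE.
    have := wb; case: (eqVneq x b) => [->|_] /=; last by case: (x == w).
    by rewrite eq_sym => /negPf->.
  by have := spath_acyclic pg cg cev => /fsetP/(_ e); rewrite !inE eqxx.
have [s sX sL] : exists2 s, s \in XC & s \in vset L.
  by apply: contrapT => no; apply: (once b) => z zX zL; case: no; exists z.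
have [t1 [C1 [Y1 [C1' [Y1' [[t1L q1 q1'] [CE YE d1 k1]]]]]]] :=
  spath_first (S := mem (vset L)) pC sX sL.
have [t2 [C2 [Y2 [C2' [Y2' [[t2L q2 q2'] [CE' YE' _ k2]]]]]]] :=
  spath_first (S := mem (vset L)) (spath_rev q1') (spath_end (spath_rev q1')) t1L.
rewrite /= in t1L t2L.
have t12 : t1 != t2.
  apply/eqP => t12; apply: (once t1) => z; rewrite YE inE => /orP[z1|z2] zL.
    exact: k1.
  move: z2; rewrite YE' inE => /orP[z2|z2]; first by rewrite t12; apply: k2.
  by move: q2' z2; rewrite -t12 => /spath_loop[_ ->]; rewrite inE => /eqP.
have Y1Q z : z \in Y1 -> z \in vset Q by move=> zY; apply: XCQ; rewrite YE inE zY.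
have Y2Q z : z \in Y2 -> z \in vset Q.
  by move=> zY; apply: XCQ; rewrite YE YE' !inE zY orbT.
have bY1 : b \notin Y1.
  apply: contra bL => bY1; rewrite (d1 b bY1) //.
  by rewrite YE' inE (spath_start q2).
have r1 : spath b t1 (e |` C1) (b |` Y1) by apply: spath_cons ee q1 bY1.
have d3 z : z \in X2 -> z \in W3 -> z = b'.
  by move=> z2 z3; apply: X2P => //; apply: (fsubsetP W3P).
have r3 : spath b t3 (B2 `|` P3) (X2 `|` W3).
  exact: spath_cat (spath_rev p2) pt3 d3.
have t3P : t3 \in WP by apply: (fsubsetP W3P); apply: spath_end pt3.
(* The foot is reached along an edge of [H] outside [L], that is, an edge common to [g] and [H],
   which leaves degree at most 2 for their symmetric difference. *)
have foot x y D Y : spath x y D Y -> D `<=` H -> x \notin vset L ->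
    (forall z, z \in Y -> z \in vset L -> z = y) -> deg L y <= 2.
  move=> q DH xL kY; have [xy|xy] := eqVneq x y.
    by move: xL; rewrite xy -deg_gt0; case: deg.
  have := spath_end q; rewrite (spath_vset _ q xy) => /vsetP[f fD yf].
  have fH := fsubsetP DH _ fD.
  have fL : f \notin L.
    apply/negP => fL.
    have : D `&` L = fset0.
      by apply: (edge_meets_once (X := Y) (t := y)) => // h z; apply: spath_ends q.
    by move/fsetP/(_ f); rewrite in_fsetI fD fL.
  apply: deg_fsymdiff_le2 => //; apply: mem_vset yf.
  by rewrite in_fsetI fH HLg.
have f1 : deg L t1 <= 2.
  apply: (foot _ _ _ _ r1) => // [|z].
    rewrite fsubUset fsub1set (fsubsetP QH _ eQ) /=.
    apply: fsubset_trans QH; apply: fsubset_trans CQ'; by rewrite CE fsubsetUl.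
  by rewrite !inE => /orP[/eqP->|]; [move/negP: bL|exact: k1].
have f2 : deg L t2 <= 2.
  apply: (foot _ _ _ _ q2) => //.
  apply: fsubset_trans QH; apply: fsubset_trans CQ'.
  by rewrite CE CE' fsubsetU// fsubsetUl orbT.
have f3 : deg L t3 <= 2.
  by apply: (foot _ _ _ _ pt3 _ (X2L _ (spath_start p2))) => //;
    apply: fsubset_trans PH.
(* The opposite tripod: a path of [L] from [t1] to [t2], divided at the vertex [c] where a path from
   [t3] first meets it. *)
have [I12 [Z12 [pI I12L]]] := Lc _ _ t1L t2L.
have [I3 [Z3 [pI3 I3L]]] := Lc _ _ t3L t1L.
have [c [J3 [V3 [J3' [V3' [[cZ j3 _] [I3E Z3E _ kc]]]]]]] :=
  spath_first (S := mem Z12) pI3 (spath_end pI3) (spath_start pI).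
have [J1 [V1 [J2 [V2 [j1 j2 I12E Z12E dV]]]]] := spath_split pI cZ.
have t13 : t1 != t3.
  apply: contraTneq (Y1Q _ (spath_end q1)) => ->; exact: PQ.
have t23 : t2 != t3.
  apply: contraTneq (Y2Q _ (spath_end q2)) => ->; exact: PQ.
pose tt := pick3 t1 t2 t3.
have Q3 z : z \in vset Q -> z \in X2 `|` W3 -> z = b.
  move=> zQ; rewrite inE => /orP[z2|z3]; first exact: h2.
  by have := PQ z (fsubsetP W3P _ z3); rewrite zQ.
apply: (no_double_tripod ccG (L := L) (b := b) (c := c) (t := tt)
  (A := pick3 (e |` C1) C2 (B2 `|` P3)) (W := pick3 (b |` Y1) Y2 (X2 `|` W3))
  (J := pick3 J1 J2 J3) (Y := pick3 V1 V2 V3)) => //.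
- by apply: ord3_ind; rewrite /tt !pick3E.
- have inj2 : forall i j, i != j -> tt i <> tt j.
    apply: ord3_sym => [i j h /esym//|||]; rewrite /tt !pick3E; exact/eqP.
  by move=> i j tij; apply: contrapT => /eqP/inj2.
- by apply: ord3_ind; rewrite /tt !pick3E.
- by apply: ord3_ind; rewrite /tt !pick3E.
- apply: ord3_sym => [i j h z zi zj|||]; rewrite ?pick3E.
  + exact: h.
  + move=> z; rewrite !inE => /orP[/eqP//|z1 z2].
    have z12 : z = t1 by apply: d1 => //; rewrite YE' inE z2.
    by move: t12; rewrite -z12 (k2 z z2) ?eqxx// z12.
  + move=> z z1; apply: Q3; move: z1; rewrite !inE => /orP[/eqP->//|]; exact: Y1Q.
  + by move=> z z2; apply: Q3; apply: Y2Q.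
- apply: ord3_ind; rewrite /tt !pick3E => z.
  + by rewrite !inE => /orP[/eqP->|]; [move/negP: bL|exact: k1].
  + exact: k2.
  + by rewrite inE => /orP[z2|]; [move/negP: (X2L _ z2)|exact: h3].
- by apply: ord3_ind; rewrite /tt !pick3E //; apply: spath_rev.
- apply: ord3_ind; rewrite /tt !pick3E.
  + by apply: fsubset_trans I12L; rewrite I12E fsubsetUl.
  + by apply: fsubset_trans I12L; rewrite I12E fsubsetUr.
  + by apply: fsubset_trans I3L; rewrite I3E fsubsetUl.
- have VZ : forall z, z \in V3 -> z \in Z12 -> z = c by exact: kc.
  apply: ord3_sym => [i j h z zi zj|||]; rewrite ?pick3E.
  + exact: h.
  + exact: dV.
  + by move=> z z1 z3; apply: VZ; rewrite ?Z12E ?inE ?z1.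
  + by move=> z z1 z3; apply: VZ; rewrite ?Z12E ?inE ?z1 ?orbT.
Qed.

(** * Components and switching *)

Lemma reach_vset A u v : reach A u v -> u != v -> u \in vset A.
Proof.
move=> [B [W [p BA]]] uv; apply: (fsubsetP (vsetS BA)).
by rewrite -(spath_vset u p uv) (spath_start p).
Qed.

Definition component M x :=
  [fset e in M | `[< exists2 y, y \in ends e & reach M x y >]].

Lemma componentP M x e : reflect (e \in M /\ exists2 y, y \in ends e & reach M x y)
  (e \in component M x).
Proof.
rewrite !inE; apply: (iffP andP) => -[eM]; first by move/asboolP.
by move=> h; split=> //; apply/asboolP.
Qed.

Lemma component_sub M x : component M x `<=` M.
Proof. by apply/fsubsetP => e /componentP[]. Qed.

Lemma vset_component M x y :
  y \in vset (component M x) <-> y \in vset M /\ reach M x y.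
Proof.
split=> [/vsetP[e /componentP[eM [z ze xz]] ye]|[/vsetP[e eM ye] xy]].
  split; first exact: mem_vset eM ye.
  exact: reach_trans xz (reach_edge eM ze ye).
by apply: (mem_vset _ ye); apply/componentP; split=> //; exists y.
Qed.

Lemma component_full M x y e : y \in vset (component M x) -> y \in ends e ->
  (e \in component M x) = (e \in M).
Proof.
move=> /vset_component[_ xy] ye; apply/idP/idP => [/componentP[]//|eM].
by apply/componentP; split=> //; exists y.
Qed.

Lemma component_connected M x : connected_set (component M x).
Proof.
move=> y z /vset_component[yM xy] /vset_component[zM xz].
have [B [W [p BM]]] := reach_trans (reach_sym xy) xz.
exists B, W; split=> //; apply/fsubsetP => e eB; apply/componentP.
split; first exact: (fsubsetP BM).
have [w we] := ends_inhabited e.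
exists w => //; apply: reach_trans xy _.
have [A1 [W1 [A2 [W2 [p1 _ BE _ _]]]]] := spath_split p (spath_ends p eB we).
by exists A1, W1; split=> //; apply: fsubset_trans BM; rewrite BE fsubsetUl.
Qed.

Lemma deg_component M x y :
  deg (component M x) y = if y \in vset (component M x) then deg M y else 0.
Proof.
case: ifP => [yL|/negbT]; last by rewrite -deg_gt0; case: deg.
by apply: deg_eq => e; apply: component_full.
Qed.

Lemma even_fsymdiff A B : even_set A -> even_set B -> even_set (fsymdiff A B).
Proof. by move=> eA eB x; rewrite odd_deg_fsymdiff (negPf (eA x)) (negPf (eB x)). Qed.

Lemma spath_even u v A W B X : spath u v A W -> spath u v B X ->
  even_set (fsymdiff A B).
Proof.
by move=> p q x; rewrite odd_deg_fsymdiff (spath_odd x p) (spath_odd x q) addbb.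
Qed.

Lemma fsymdiff0 (T : choiceType) (A : {fset T}) : fsymdiff A fset0 = A.
Proof. by apply/fsetP => x; rewrite in_fsymdiff in_fset0 addbF. Qed.

(* If [g] switched along the component is not a path then it splits into a path
   [P] and an even set [Q]. As [d] is acyclic, some other component of
   [fsymdiff g d] joins [Q] to [P]. *)
Lemma spath_switch_component (ccG : controlled_cycles G) u v g Wg d Wd x :
  spath u v g Wg -> spath u v d Wd ->
  exists W, spath u v (fsymdiff g (component (fsymdiff g d) x)) W.
Proof.
move=> pg pd; set M := fsymdiff g d; set L := component M x.
have LM : L `<=` M by apply: component_sub.
have [uv|uv] := eqVneq u v.
  subst v; exists Wg; have [g0 _] := spath_loop pg; have [d0 _] := spath_loop pd.
  move: LM; rewrite /M g0 d0 fsymdiff0 fsubset0 => /eqP ->.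
  by rewrite fsymdiff0 -g0.
have Mev : even_set M by apply: spath_even pg pd.
have Lev : even_set L.
  by move=> y; rewrite deg_component; case: ifP => // _; apply: Mev.
set H := fsymdiff g L.
(* Around a vertex of [L] the set [H] agrees with [d], and around any other vertex with [g]. *)
have H2 y : deg H y <= 2.
  have [yL|yL] := boolP (y \in vset L).
    rewrite -(deg_eq (A := d)) ?(spath_deg y pd)// => e ye.
    rewrite in_fsymdiff /L (component_full yL ye) in_fsymdiff.
    by case: (e \in g); case: (e \in d).
  rewrite -(deg_eq (A := g)) ?(spath_deg y pg)// => e ye; rewrite in_fsymdiff.
  case: (boolP (e \in L)) => [eL|]; last by rewrite addbF.
  by case/negP: yL; apply: mem_vset eL ye.
have Ho y : odd (deg H y) = (y == u) (+) (y == v).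
  by rewrite odd_deg_fsymdiff (negPf (Lev y)) addbF (spath_odd y pg).
have [P [WP [pP PH]]] := odd_reach uv Ho.
set Q := H `\` P.
have [Q0|/eqP Qn0] := eqVneq Q fset0.
  exists WP; suff <- : P = H by [].
  by apply/eqP; rewrite eqEfsubset PH -fsetD_eq0 -/Q Q0 eqxx.
have Qev : even_set Q.
  by apply: even_deg_fsetD => // y; rewrite Ho (spath_odd y pP).
have backL x0 y : x0 \notin vset L -> reach M x0 y -> y \notin vset L.
  move=> x0L x0y; apply: contra x0L => yL.
  have [<- //|yx] := eqVneq y x0.
  apply/vset_component; split; first by apply: reach_vset x0y _; rewrite eq_sym.
  by have [_ xy] := (vset_component _ _ _).1 yL; apply: reach_trans xy (reach_sym x0y).
exfalso.
have [[x0 [y0 [x0Q x0L y0P xy0]]]|sep] := pselect (exists x0 y0,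
    [/\ x0 \in vset Q, x0 \notin vset L, y0 \in WP & reach M x0 y0]).
  have [B [X [pB BM]]] := xy0.
  apply: (no_reconnection ccG uv pg H2 Ho _ pP PH pB x0Q y0P).
    by rewrite fsymdiffK; apply: component_connected.
  rewrite fsymdiffK => z zX; apply: (backL x0) => //.
  have [A1 [W1 [A2 [W2 [p1 _ BE _ _]]]]] := spath_split pB zX.
  by exists A1, W1; split=> //; apply: fsubset_trans BM; rewrite BE fsubsetUl.
(* [U] collects the components of [M], other than [L], that meet [Q]. As none of them meets [P],
   [fsymdiff Q U] is an even subset of [d], so [Q = U]; being off [L], [Q] then lies in [g] and is
   empty. *)
pose near y := exists x0, [/\ x0 \in vset Q, x0 \notin vset L & reach M x0 y].
pose U := [fset e in M | `[< exists2 y, y \in ends e & near y >]].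
have UP e : e \in U <-> e \in M /\ exists2 y, y \in ends e & near y.
  rewrite !inE; split=> [/andP[-> /asboolP]//|[-> h]]; exact/asboolP.
have Uends e y : e \in U -> y \in ends e -> near y.
  move=> /UP[eM [z ze [x0 [x0Q x0L x0z]]]] ye; exists x0; split=> //.
  exact: reach_trans x0z (reach_edge eM ze ye).
have near_notin y : near y -> y \notin vset L.
  by move=> [x0 [_ x0L x0y]]; apply: backL x0y.
have Uev : even_set U.
  move=> y; have [/vsetP[e eU ye]|] := boolP (y \in vset U); last first.
    by rewrite -deg_gt0; case: deg.
  rewrite (deg_eq (B := M)); first exact: Mev.
  move=> f yf; apply/idP/idP => [/UP[]//|fM]; apply/UP; split=> //.
  by exists y => //; apply: Uends eU ye.
have QUd : fsymdiff Q U `<=` d.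
  apply/fsubsetP => e; rewrite in_fsymdiff.
  have [x1 x1e] := ends_inhabited e.
  have [eU|eU] := boolP (e \in U); rewrite ?addbT ?addbF => eQ.
    have x1n := Uends _ _ eU x1e.
    have eL : e \notin L.
      by apply/negP => eL; case/negP: (near_notin _ x1n); apply: mem_vset eL x1e.
    have /UP[eM _] := eU; apply: contraTT eM => ed.
    rewrite in_fsymdiff (negPf ed) addbF; apply/negP => eg.
    have eH : e \in H by rewrite in_fsymdiff eg (negPf eL).
    have eP : e \in P by move: eQ; rewrite in_fsetD eH andbT negbK.
    have [x0 [x0Q x0L x0x]] := x1n; apply: sep; exists x0, x1; split=> //.
    exact: spath_ends pP eP x1e.
  have eH : e \in H by move: eQ; rewrite in_fsetD => /andP[].
  have [eL|eL] := boolP (e \in L).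
    have := fsubsetP LM _ eL; move: eH; rewrite !in_fsymdiff eL addbT.
    by move/negPf ->.
  have eg : e \in g by move: eH; rewrite in_fsymdiff (negPf eL) addbF.
  apply: contraNT eU => ed; have eM : e \in M by rewrite in_fsymdiff eg (negPf ed).
  apply/UP; split=> //; exists x1 => //; exists x1; split.
  - exact: mem_vset eQ x1e.
  - apply/negP => x1L; case/negP: eL; rewrite (component_full x1L x1e) //.
  - exact: reach_refl.
have QU0 := spath_acyclic pd QUd (even_fsymdiff Qev Uev).
have UQ0 : fsymdiff U Q = fset0 by rewrite -QU0 /fsymdiff fsetUC.
have QU : Q = U by rewrite -(fsymdiffK U Q) UQ0 fsymdiff0.
apply: Qn0; apply: (spath_acyclic pg _ Qev); apply/fsubsetP => e eQ.
have [x1 x1e] := ends_inhabited e.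
have eL : e \notin L.
  apply/negP => eL; have eU : e \in U by rewrite -QU.
  by case/negP: (near_notin _ (Uends _ _ eU x1e)); apply: mem_vset eL x1e.
by move: eQ; rewrite in_fsetD in_fsymdiff (negPf eL) addbF => /andP[].
Qed.

(** Suppose the double switch splits into a path [P] and a nonempty even set [Q]. If [Q] had no edge
    of [K] it would be an even subset of [g2]; if [P] had none it would equal [g2], and [K] would be
    an even subset of [g1]. So the connected set [K] joins [Q] to [P] away from [K'], which
    [no_reconnection] forbids. *)
Lemma spath_switch_two (ccG : controlled_cycles G) u v g Wg K W1 K' W2 :
  spath u v g Wg -> spath u v (fsymdiff g K) W1 -> spath u v (fsymdiff g K') W2 ->
  connected_set K -> connected_set K' -> vset K `&` vset K' = fset0 ->
  exists W, spath u v (fsymdiff (fsymdiff g K) K') W.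
Proof.
move=> pg p1 p2 cK cK' dis.
have disV z : z \in vset K -> z \in vset K' -> False.
  by move=> zK zK'; move/fsetP/(_ z): dis; rewrite !inE zK zK'.
have disE e : e \in K -> e \notin K'.
  move=> eK; apply/negP => eK'.
  have [x xe] := ends_inhabited e.
  exact: disV (mem_vset eK xe) (mem_vset eK' xe).
have Kev : even_set K by have := spath_even pg p1; rewrite fsymdiffK.
have K'ev : even_set K' by have := spath_even pg p2; rewrite fsymdiffK.
set g1 := fsymdiff g K in p1 *; set g2 := fsymdiff g K' in p2 *.
set H := fsymdiff g1 K'.
have [uv|uv] := eqVneq u v.
  subst v; exists Wg; have [g0 _] := spath_loop pg.
  have [g10 _] := spath_loop p1; have [g20 _] := spath_loop p2.
  have K'0 : K' = fset0 by rewrite -(fsymdiffK g K') -/g2 g20 g0 fsymdiff0.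
  by rewrite /H g10 K'0 fsymdiff0 -g0.
have [K0|Kn0] := eqVneq K fset0.
  by exists W2; rewrite /H /g1 K0 fsymdiff0.
have Hg2 : H = fsymdiff g2 K.
  apply/fsetP => e; rewrite !in_fsymdiff.
  by case: (e \in g); case: (e \in K); case: (e \in K').
have H2 y : deg H y <= 2.
  have [yK|yK] := boolP (y \in vset K).
    rewrite -(deg_eq (A := g1)) ?(spath_deg y p1)// => e ye.
    rewrite [RHS]in_fsymdiff; case: (boolP (e \in K')) => [eK'|]; last by rewrite addbF.
    by case: (disV y yK); apply: mem_vset eK' ye.
  rewrite Hg2 -(deg_eq (A := g2)) ?(spath_deg y p2)// => e ye.
  rewrite [RHS]in_fsymdiff; case: (boolP (e \in K)) => [eK|]; last by rewrite addbF.
  by case/negP: yK; apply: mem_vset eK ye.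
have Ho y : odd (deg H y) = (y == u) (+) (y == v).
  by rewrite odd_deg_fsymdiff (negPf (K'ev y)) addbF (spath_odd y p1).
have [P [WP [pP PH]]] := odd_reach uv Ho.
set Q := H `\` P.
have [Q0|/eqP Qn0] := eqVneq Q fset0.
  exists WP; suff <- : P = H by [].
  by apply/eqP; rewrite eqEfsubset PH -fsetD_eq0 -/Q Q0 eqxx.
have Qev : even_set Q.
  by apply: even_deg_fsetD => // y; rewrite Ho (spath_odd y pP).
have meetsK A : A `<=` H -> ~ A `<=` g2 -> exists2 e, e \in A & e \in K.
  move=> AH Ag; apply: contrapT => no; apply: Ag; apply/fsubsetP => e eA.
  have eK : e \notin K by apply/negP => eK; apply: no; exists e.
  by have := fsubsetP AH _ eA; rewrite Hg2 in_fsymdiff (negPf eK) addbF.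
exfalso.
have [e eQ eK] : exists2 e, e \in Q & e \in K.
  apply: meetsK; first exact: fsubsetDl.
  by move=> Qg2; apply: Qn0; apply: spath_acyclic p2 Qg2 Qev.
have [f fP fK] : exists2 e, e \in P & e \in K.
  apply: meetsK => // Pg2.
  have Pg2E := spath_eq_of_sub p2 Pg2 (fun x => spath_odd x pP).
  move/eqP: Kn0; apply; apply: (spath_acyclic p1 _ Kev).
  apply/fsubsetP => h hK; rewrite in_fsymdiff hK addbT; apply/negP => hg.
  have : h \in P by rewrite Pg2E in_fsymdiff hg (negPf (disE _ hK)).
  by move/(fsubsetP PH); rewrite in_fsymdiff in_fsymdiff hg hK (negPf (disE _ hK)).
have [x xe] := ends_inhabited e.
have [y yf] := ends_inhabited f.
have [B [X [pB BK]]] := cK x y (mem_vset eK xe) (mem_vset fK yf).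
apply: (no_reconnection ccG uv p1 H2 Ho _ pP PH pB).
- by rewrite fsymdiffK.
- exact: mem_vset eQ xe.
- exact: spath_ends pP fP yf.
- rewrite fsymdiffK => z zX; apply/negP => zK'; apply: (disV z) => //.
  exact: (fsubsetP (spath_sub_vset pB BK (mem_vset eK xe))).
Qed.

(** After one switch the remaining ones still yield simple paths by [spath_switch_two], so they can
    be performed in turn. *)
Lemma spath_switch_family (ccG : controlled_cycles G) (I : eqType) u v
    (K : I -> {fset E}) (s : seq I) g Wg :
  spath u v g Wg -> uniq s ->
  (forall i, i \in s -> exists W, spath u v (fsymdiff g (K i)) W) ->
  (forall i, connected_set (K i)) ->
  (forall i j, i != j -> vset (K i) `&` vset (K j) = fset0) ->
  exists W, spath u v (fsymdiff g (\bigcup_(i <- s) K i)) W.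
Proof.
move=> pg us ps cK dK; elim: s g Wg pg us ps => [|i s IH] g Wg pg.
  by move=> _ _; exists Wg; rewrite big_nil fsymdiff0.
move=> /= /andP[is_ us] ps.
have [W1 p1] := ps i (mem_head _ _).
have [|W pW] := IH _ _ p1 us.
  move=> j js; have [|W2 p2] := ps j; first by rewrite inE js orbT.
  apply: (spath_switch_two ccG pg p1 p2) => //; apply: dK.
  by apply: contraNneq is_ => ->.
exists W; move: pW; rewrite big_cons; congr (spath _ _ _ _).
apply/fsetP => e; rewrite !in_fsymdiff in_fsetU -addbA; congr (_ (+) _).
case: (boolP (e \in K i)) => //= eKi; apply/negP.
move=> /bigfcupP[j /andP[js _] eKj].
have [x xe] := ends_inhabited e.
have ij : i != j by apply: contraNneq is_ => ->.
by move/fsetP/(_ x): (dK _ _ ij); rewrite !inE (mem_vset eKi xe) (mem_vset eKj xe).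
Qed.

(** * Bounded degree: many disjoint switches or few nearby paths *)

Lemma bounded_degree_fset : bounded_degree G -> exists D, forall v,
  exists2 A : {fset E}, #|` A| <= D & forall e, v \in ends e -> e \in A.
Proof.
by move=> [D hD]; exists D => v; have /card_le_fsetP := hD v.
Qed.

(** In each step a vertex contributes itself and both ends of at most [D] edges, whence the factor
    [1 + D * 2]. *)
Lemma spath_ball D n W :
  (forall v, exists2 A : {fset E}, #|` A| <= D & forall e, v \in ends e -> e \in A) ->
  exists2 W' : {fset V}, #|` W'| <= #|` W| * (1 + D * 2) ^ n
    & forall u v B X, spath u v B X -> u \in W -> #|` B| <= n -> v \in W'.
Proof.
move=> deg_; have /choice [inc incP] : forall v, exists A : {fset E},
    #|` A| <= D /\ forall e, v \in ends e -> e \in A.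
  by move=> v; have [A A1 A2] := deg_ v; exists A.
elim: n W => [|n IH] W.
  exists W; first by rewrite muln1.
  move=> u v B X; case=> // a w b e A Y ee p aY _.
  have eA : e \notin A.
    by apply: contra aY => eA; apply: (spath_ends p eA); rewrite ee !inE eqxx.
  by rewrite cardfsU1 eA.
pose next := W `|` \bigcup_(v <- W) \bigcup_(e <- inc v) ends e.
have [W' W'n h] := IH next.
exists W'.
  apply: leq_trans W'n _; rewrite expnS mulnA leq_mul2r; apply/orP; right.
  rewrite cardfsU mulnDr muln1; apply: leq_trans (leq_subr _ _) _.
  rewrite leq_add2l; apply: card_bigfcup_seq => v.
  apply: (@leq_trans (size (inc v) * 2)).
    by apply: card_bigfcup_seq => e; rewrite ends_card.
  by rewrite leq_mul2r (incP v).1 orbT.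
move=> u v B X p; case: p => [a aW _|a w b e A Y ee q aY aW].
  by apply: (h _ _ _ _ (spath_nil a)); rewrite ?cardfs0// inE aW.
have eA : e \notin A.
  by apply: contra aY => eA; apply: (spath_ends q eA); rewrite ee !inE eqxx.
rewrite cardfsU1 eA add1n ltnS => An; apply: h q _ An; rewrite inE.
apply/orP; right; apply/bigfcupP; exists a; first by rewrite aW.
apply/bigfcupP; exists e; last by rewrite ee !inE eqxx orbT.
by rewrite andbT; apply: (incP a).2; rewrite ee !inE eqxx.
Qed.

(** A connected set of at most [r] edges that meets [W] stays within distance [r] of [W]. The
    constant depends only on [r] and the degree bound. *)
Lemma connected_neighbourhood (dG : bounded_degree G) (r : nat) :
  exists c : nat, forall W,
  exists2 Om : {fset E}, #|` Om| <= #|` W| * c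
    & forall K x, connected_set K -> #|` K| <= r -> x \in vset K -> x \in W ->
        K `<=` Om.
Proof.
have [D hD] := bounded_degree_fset dG.
have /choice [inc incP] : forall v, exists A : {fset E},
    #|` A| <= D /\ forall e, v \in ends e -> e \in A.
  by move=> v; have [A A1 A2] := hD v; exists A.
exists ((1 + D * 2) ^ r * D) => W; have [W' W'n hW'] := spath_ball r W hD.
exists (\bigcup_(v <- W') inc v).
  rewrite mulnA; apply: (@leq_trans (#|` W'| * D)); last by rewrite leq_mul2r W'n orbT.
  by apply: card_bigfcup_seq => v; case: (incP v).
move=> K x cK Kr xK xW; apply/fsubsetP => e eK.
have [z ze] := ends_inhabited e.
have [B [X [p BK]]] := cK _ _ xK (mem_vset eK ze).
apply/bigfcupP; exists z; last exact: (incP z).2.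
rewrite andbT; apply: (hW' _ _ _ _ p xW); apply: leq_trans Kr.
exact: fsubset_leq_card.
Qed.

Lemma vset_card A : #|` vset A| <= #|` A| * 2.
Proof. by apply: card_bigfcup_seq => e; rewrite ends_card. Qed.

Definition local_switch r u v g K := [/\ connected_set K, K != fset0, #|` K| <= r
  & exists W, spath u v (fsymdiff g K) W].

(** Greedy packing: when no further disjoint switch exists, the vertices of those already chosen, at
    most [r * 2] for each, meet every switch. *)
Lemma disjoint_switches_or_cover r u v g N :
  (exists K : nat -> {fset E}, (forall i, i < N -> local_switch r u v g (K i)) /\
     forall i j, i < N -> j < N -> i != j -> vset (K i) `&` vset (K j) = fset0) \/
  exists2 W : {fset V}, #|` W| <= N * (r * 2)
    & forall K, local_switch r u v g K -> exists2 x, x \in vset K & x \in W.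
Proof.
elim: N => [|N [[K [Kgood Kdis]]|[W WN h]]].
- by left; exists (fun=> fset0).
- pose W := \bigcup_(i <- iota 0 N) (if i < N then vset (K i) else fset0).
  have WN : #|` W| <= N * (r * 2).
    rewrite -[N in N * _](size_iota 0); apply: card_bigfcup_seq => i.
    case: ifP => iN; rewrite ?cardfs0//; apply: leq_trans (vset_card _) _.
    by rewrite leq_mul2r; have [_ _ -> _] := Kgood i iN; rewrite orbT.
  have [h|/existsNP[K' /not_implyP[K'good noW]]] := pselect (forall K,
      local_switch r u v g K -> exists2 x, x \in vset K & x \in W).
    by right; exists W => //; apply: leq_trans WN _; rewrite leq_mul2r leqnSn orbT.
  have dis i : i < N -> vset (K i) `&` vset K' = fset0.
    move=> iN; apply/eqP; rewrite -fsubset0; apply/fsubsetP => x.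
    rewrite inE => /andP[xK xK']; exfalso; apply: noW; exists x => //.
    by apply/bigfcupP; exists i; rewrite ?mem_iota ?iN.
  left; exists (fun i => if i == N then K' else K i); split=> [i|i j].
    by rewrite ltnS leq_eqVlt; case: eqP => //= _; apply: Kgood.
  rewrite (ltnS i) (ltnS j) (leq_eqVlt i) (leq_eqVlt j).
  case: (eqVneq i N) => [->|iN] /=; case: (eqVneq j N) => [->|jN] //=.
  - by move=> _ jN' _; rewrite fsetIC dis.
  - by move=> iN' _ _; apply: dis.
  - exact: Kdis.
- by right; exists W => //; apply: leq_trans WN _; rewrite leq_mul2r leqnSn orbT.
Qed.

Lemma component_nonempty M x : x \in vset M -> component M x != fset0.
Proof.
move=> xM; apply/eqP => c0.
have : x \in vset (component M x) by apply/vset_component; split=> //; apply: reach_refl.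
by rewrite c0 => /vsetP[e]; rewrite inE.
Qed.

Lemma component_local_switch (ccG : controlled_cycles G) r u v g Wg d Wd x :
  spath u v g Wg -> spath u v d Wd -> #|` fsymdiff g d| <= r ->
  x \in vset (fsymdiff g d) -> local_switch r u v g (component (fsymdiff g d) x).
Proof.
move=> pg pd Mr xM; split.
- exact: component_connected.
- exact: component_nonempty.
- by apply: leq_trans Mr; apply: fsubset_leq_card; apply: component_sub.
- exact: spath_switch_component pg pd.
Qed.

(** Each component of the symmetric difference is itself a local switch, so it meets [W] and is
    confined to [Om]. *)
Lemma fsymdiff_sub_cover (ccG : controlled_cycles G) r u v g Wg W Om :
  spath u v g Wg ->
  (forall K x, connected_set K -> #|` K| <= r -> x \in vset K -> x \in W -> K `<=` Om) ->
  (forall K, local_switch r u v g K -> exists2 x, x \in vset K & x \in W) ->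
  forall d Wd, spath u v d Wd -> #|` fsymdiff g d| <= r -> fsymdiff g d `<=` Om.
Proof.
move=> pg nW hW d Wd pd Mr; apply/fsubsetP => e eM.
have [x xe] := ends_inhabited e.
have xM := mem_vset eM xe.
have sw := component_local_switch ccG pg pd Mr xM.
have [z zK zW] := hW _ sw; have [cK _ Kr _] := sw.
apply: (fsubsetP (nW _ _ cK Kr zK zW)); apply/componentP; split=> //.
by exists x => //; apply: reach_refl.
Qed.

(** In the second case at most [2 ^ c] paths lie within distance [r] of [g], with [c] independent of
    [g]; a sufficiently large ball therefore forces [N] disjoint switches. *)
Lemma switches_or_few_paths (ccG : controlled_cycles G) (dG : bounded_degree G) N r :
  exists c : nat, forall u v g Wg, spath u v g Wg ->
  (exists K : nat -> {fset E}, (forall i, i < N -> local_switch r u v g (K i)) /\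
     forall i j, i < N -> j < N -> i != j -> vset (K i) `&` vset (K j) = fset0) \/
  exists2 Om : {fset E}, #|` Om| <= c
    & forall d Wd, spath u v d Wd -> #|` fsymdiff g d| <= r -> fsymdiff g d `<=` Om.
Proof.
have [C hC] := connected_neighbourhood dG r; exists (N * (r * 2) * C) => u v g Wg pg.
have [K|[W WN hW]] := disjoint_switches_or_cover r u v g N; first by left.
right; have [Om OmC hOm] := hC W; exists Om.
  by apply: leq_trans OmC _; rewrite leq_mul2r WN orbT.
exact: (fsymdiff_sub_cover ccG pg hOm hW).
Qed.

(** The vertices of [g] already form a cover: a nonempty switch without an edge of [g] would be an
    even subset of the switched path. The resulting [Om] depends on [g]. *)
Lemma locally_finite_paths (ccG : controlled_cycles G) (dG : bounded_degree G) r
    u v g Wg : spath u v g Wg ->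
  exists Om : {fset E}, forall d Wd, spath u v d Wd -> #|` fsymdiff g d| <= r ->
    fsymdiff g d `<=` Om.
Proof.
move=> pg; have [C hC] := connected_neighbourhood dG r.
have [Om _ hOm] := hC Wg; exists Om.
apply: (fsymdiff_sub_cover ccG pg hOm) => K [cK Kn0 Kr [W pW]].
have Kev : even_set K by have := spath_even pg pW; rewrite fsymdiffK.
have [e eK eg] : exists2 e, e \in K & e \in g.
  apply: contrapT => no; move/eqP: Kn0; apply; apply: (spath_acyclic pW _ Kev).
  apply/fsubsetP => e eK; rewrite in_fsymdiff eK addbT; apply/negP => eg.
  by apply: no; exists e.
have [x xe] := ends_inhabited e.
by exists x; [exact: mem_vset eK xe|exact: spath_ends pg eg xe].
Qed.

End Graph.

(** * Homology covers of graphs of large girth *)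

Section Word.
Variable n : nat.
Implicit Types (a b : 'I_3) (w : seq 'I_3).

(* Crossing the edge of colour [a] in the 3-regular tree of depth [n], whose
   vertices are the words without repeated adjacent letters; the branches
   missing at depth [n] and the other words are fixed points. *)
Definition word_step w a :=
  if ohead w == Some a then if ohead (behead w) == Some a then w else behead w
  else if size w < n then a :: w else w.

Lemma word_stepK w a : size w <= n -> word_step (word_step w a) a = w.
Proof.
rewrite /word_step; case: (boolP (ohead w == Some a)) => [wa|wa] wn.
  case: (boolP (ohead (behead w) == Some a)) => w'a; first by rewrite wa w'a.
  move: wa w'a wn; case: w => //= b w /eqP[->] w'a wn.
  by rewrite (negPf w'a) wn.
case: (boolP (size w < n)) => wn' /=; first by rewrite eqxx (negPf wa).
by rewrite (negPf wa) (negPf wn').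
Qed.

Lemma size_word_step w a : size w <= n -> size (word_step w a) <= n.
Proof.
rewrite /word_step => wn; case: ifP => _; last by case: ifP.
by case: ifP => // _; rewrite size_behead; apply: leq_trans (leq_pred _) wn.
Qed.

Lemma foldl_word_step w : sorted (fun a b => a != b) w -> size w <= n ->
  foldl word_step [::] w = rev w.
Proof.
elim/last_ind: w => // w a IH; rewrite size_rcons => ws wn.
have ws' : sorted (fun a b => a != b) w.
  by move: ws; case: (w) => //= b w'; rewrite rcons_path => /andP[].
rewrite foldl_rcons (IH ws' (ltnW wn)) rev_rcons /word_step size_rev wn.
case: eqP => // /=; move: ws; case/lastP: w {IH ws' wn} => // w b.
by rewrite -cats1 -cats1 -catA rev_cat /= => + [ba]; rewrite ba;
  case: w => [|c w] /=; rewrite ?cat_path /= eqxx ?andbF.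
Qed.

Definition bseq_step a (w : n.-bseq 'I_3) : n.-bseq 'I_3 :=
  Bseq (size_word_step a (size_bseq w)).

Lemma bseq_stepK a : involutive (bseq_step a).
Proof. by move=> w; apply: val_inj; rewrite /= word_stepK// size_bseq. Qed.

Definition step_perm a := perm (inv_inj (bseq_stepK a)).

End Word.

(* The Cayley graph of the permutation group generated by the three
   colours (Biggs): a reduced closed word would fix the root of the tree. *)
Lemma large_girth_graph n : exists (X : finType) (mv : X -> 'I_3 -> X),
  [/\ inhabited X, forall x a, mv (mv x a) a = x
    & forall x s, sorted (fun a b => a != b) s -> 0 < size s <= n ->
        foldl mv x s != x].
Proof.
exists {perm n.-bseq 'I_3}, (fun x a => x * step_perm n a)%g; split.
- exact: inhabits 1%g.
- move=> x a; have aa : (step_perm n a * step_perm n a = 1)%g.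
    by apply/perm.permP => w; rewrite permM !permE; apply: bseq_stepK.
  by rewrite -mulgA aa mulg1.
- move=> x s ss /andP[s0 sn]; apply/eqP => xs.
  have act w : val (foldl (fun x a => x * step_perm n a)%g x s w) =
      foldl (word_step n) (val (x w)) s.
    elim: (s) (x) => //= a t IH y; rewrite IH permM permE //.
  have := act (x^-1 [bseq])%g; rewrite xs permKV /= foldl_word_step//.
  by move: s0; rewrite -size_rev => + s0; rewrite -s0.
Qed.

(** * Mod 2 chains and the homology cover *)

Section Cover.
Variables (X : finType) (mv : X -> 'I_3 -> X) (n : nat) (x0 : X).
Hypothesis n_gt0 : 0 < n.
Hypothesis mvK : forall x a, mv (mv x a) a = x.
Hypothesis girth : forall x s, sorted (fun a b => a != b) s -> 0 < size s <= n ->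
  foldl mv x s != x.
Implicit Types (x y z : X) (a b : 'I_3).

Local Notation edgeT := {set X * 'I_3}.
Implicit Types (c d Z : {set edgeT}).

(** As the set of its two half-edges, an edge does not depend on the end from which it is named. Not
    every element of [edgeT] is an edge, hence [genuine]. *)
Definition half_edges x a : edgeT := [set (x, a); (mv x a, a)].

Definition sdiff (T : finType) (A B : {set T}) := (A :\: B) :|: (B :\: A).

Lemma in_sdiff (T : finType) (A B : {set T}) t :
  (t \in sdiff A B) = (t \in A) (+) (t \in B).
Proof. by rewrite !inE; case: (t \in A); case: (t \in B). Qed.

Lemma sdiffC (T : finType) (A B : {set T}) : sdiff A B = sdiff B A.
Proof. by rewrite /sdiff finset.setUC. Qed.

Lemma sdiffK (T : finType) (A B : {set T}) : sdiff A (sdiff A B) = B.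
Proof. by apply/setP => t; rewrite !in_sdiff addKb. Qed.

Lemma sdiffA (T : finType) (A B C : {set T}) :
  sdiff A (sdiff B C) = sdiff (sdiff A B) C.
Proof. by apply/setP => t; rewrite !in_sdiff addbA. Qed.

Lemma sdiff0 (T : finType) (A : {set T}) : sdiff A finset.set0 = A.
Proof. by apply/setP => t; rewrite in_sdiff finset.in_set0 addbF. Qed.

Lemma sdiffv (T : finType) (A : {set T}) : sdiff A A = finset.set0.
Proof. by apply/setP => t; rewrite in_sdiff addbb finset.in_set0. Qed.

Lemma odd_sdiff (T : finType) (A B : {set T}) :
  odd #|sdiff A B| = odd #|A| (+) odd #|B|.
Proof.
have := cardsID B A; have := cardsID A B; rewrite /sdiff (finset.setIC B A).
rewrite cardsU.
have -> : (A :\: B) :&: (B :\: A) = finset.set0.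
  by apply/setP => t; rewrite !inE; case: (t \in A); rewrite ?andbF.
rewrite cards0 subn0 => <- <-; rewrite !oddD.
by case: (odd #|A :&: B|); case: (odd #|A :\: B|); case: (odd #|B :\: A|).
Qed.

Lemma mv_neq x a : mv x a != x.
Proof. by have := girth x (s := [:: a]) isT n_gt0. Qed.

Lemma half_edgesK x a : half_edges (mv x a) a = half_edges x a.
Proof. by rewrite /half_edges mvK finset.setUC. Qed.

Lemma half_edges_eq x y a b : (half_edges x a == half_edges y b) =
  (a == b) && ((y == x) || (y == mv x a)).
Proof.
apply/eqP/idP => [xy|/andP[/eqP <- /orP[]/eqP->//]]; last by rewrite half_edgesK.
have : (y, b) \in half_edges x a by rewrite xy !inE eqxx.
by rewrite !inE !xpair_eqE => /orP[]/andP[-> /eqP->]; rewrite eqxx ?orbT.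
Qed.

Definition star c y := [set a | half_edges y a \in c].
Definition genuine c := [forall e in c, exists p, e == half_edges p.1 p.2].
(** The mod 2 boundary is the sum of [x] and [y], so it vanishes when [x = y]. *)
Definition boundary c x y := [forall z, odd #|star c z| == (z == x) (+) (z == y)].

Lemma boundaryP c x y z : boundary c x y -> odd #|star c z| = (z == x) (+) (z == y).
Proof. by move/forallP/(_ z)/eqP. Qed.

Lemma star_sdiff c d y : star (sdiff c d) y = sdiff (star c y) (star d y).
Proof. by apply/setP => a; rewrite in_sdiff [LHS]inE in_sdiff !inE. Qed.

Lemma genuine_sdiff c d : genuine c -> genuine d -> genuine (sdiff c d).
Proof.
move=> /forallP gc /forallP gd; apply/forallP => e; apply/implyP.
by rewrite !inE => /orP[]/andP[_ h]; [move: (gc e)|move: (gd e)]; rewrite h.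
Qed.

Lemma boundary_sdiff c d x y z : boundary c x y -> boundary d y z ->
  boundary (sdiff c d) x z.
Proof.
move=> cxy dyz; apply/forallP => t; rewrite star_sdiff odd_sdiff.
rewrite (boundaryP _ cxy) (boundaryP _ dyz); apply/eqP.
by case: (t == x); case: (t == y); case: (t == z).
Qed.

Lemma boundaryC c x y : boundary c x y = boundary c y x.
Proof. by apply: eq_forallb => z; rewrite addbC. Qed.

Lemma star1 x a y : star [set half_edges x a] y =
  if (y == x) || (y == mv x a) then [set a] else finset.set0.
Proof.
apply/setP => b; rewrite !inE eq_sym half_edges_eq eq_sym.
by case: ifP; rewrite ?inE ?andbT ?andbF // eq_sym.
Qed.

Lemma genuine1 x a : genuine [set half_edges x a].
Proof.
by apply/forallP => e; apply/implyP; rewrite inE => /eqP->; apply/existsP; exists (x, a).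
Qed.

Lemma boundary1 x a : boundary [set half_edges x a] x (mv x a).
Proof.
apply/forallP => y; rewrite star1; case: (eqVneq y x) => [->|yx] /=.
  by rewrite (eq_sym x) (negPf (mv_neq x a)) cards1.
by case: ifP; rewrite ?cards1 ?cards0.
Qed.

(* If no vertex were a leaf, [Z] would carry a non-backtracking walk, whose
   first [n] edges are distinct by the girth condition. *)
Lemma leaf_exists Z : genuine Z -> Z != finset.set0 -> #|Z| < n ->
  exists y, #|star Z y| = 1.
Proof.
move=> gZ /set0Pn[e0 e0Z] Zn; apply: contrapT => noleaf.
have [p0 p0Z] : exists p, half_edges p.1 p.2 \in Z.
  have /forallP/(_ e0) := gZ; rewrite e0Z /= => /existsP[p /eqP ep].
  by exists p; rewrite -ep.
(* One step of a non-backtracking walk in [Z]. The default [p.2] is never taken, since then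
   [mv p.1 p.2] would be a leaf. *)
pose f (p : X * 'I_3) := (mv p.1 p.2,
  odflt p.2 [pick b | (b != p.2) && (half_edges (mv p.1 p.2) b \in Z)]).
have fP p : half_edges p.1 p.2 \in Z ->
    (f p).2 != p.2 /\ half_edges (f p).1 (f p).2 \in Z.
  move=> pZ; rewrite /f /=; case: pickP => [b /andP[]//|none]; exfalso.
  apply: noleaf; exists (mv p.1 p.2).
  have -> : star Z (mv p.1 p.2) = [set p.2]; last by rewrite cards1.
  apply/setP => b; rewrite !inE; case: eqP => [->|/eqP bp].
    by rewrite half_edgesK.
  by have := none b; rewrite bp.
pose s k := iter k f p0.
have sZ k : half_edges (s k).1 (s k).2 \in Z.
  by elim: k => // k IH; have [_] := fP _ IH.
have s2 k : (s k.+1).2 != (s k).2 by have [] := fP _ (sZ k).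
have walk i m : (s (i + m)).1 = foldl mv (s i).1 [seq (s k).2 | k <- iota i m].
  elim: m => [|m IH]; first by rewrite addn0.
  by rewrite -[m.+1]addn1 iotaD map_cat foldl_cat -IH addnA addn1.
have nonback i m : sorted (fun a b => a != b) [seq (s k).2 | k <- iota i m].
  elim: m i => // -[|m] IH i //; have := IH i.+1.
  by rewrite /= => ->; rewrite eq_sym s2.
have dist i j : i < j -> j - i <= n -> (s j).1 != (s i).1.
  move=> ij jin; rewrite -(subnKC (ltnW ij)) walk girth// size_map size_iota.
  by rewrite subn_gt0 ij.
have inj : injective (fun k : 'I_n => half_edges (s k).1 (s k).2).
  suff ltinj (i j : 'I_n) : i < j ->
      half_edges (s i).1 (s i).2 != half_edges (s j).1 (s j).2.
    move=> i j ij; apply: val_inj; case: (ltngtP i j) => // lt.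
      by have := ltinj _ _ lt; rewrite ij eqxx.
    by have := ltinj _ _ lt; rewrite ij eqxx.
  move=> ij; rewrite half_edges_eq.
  have jn : j - i <= n by apply: leq_trans (leq_subr _ _) (ltnW (ltn_ord j)).
  rewrite (negPf (dist _ _ ij jn)) /=; apply/negP => /andP[/eqP a12].
  rewrite -[mv _ _]/(s i.+1).1; move: ij; rewrite leq_eqVlt => /orP[/eqP ij|ij].
    by have := s2 i; rewrite ij a12 eqxx.
  apply/negP; apply: dist => //; apply: leq_trans (leq_subr _ _) (ltnW (ltn_ord j)).
have := Zn; rewrite ltnNge => /negP; apply.
rewrite -[n in n <= _]card_ord -(card_imset _ inj); apply: subset_leq_card.
by apply/fintype.subsetP => e /imsetP[k _ ->].
Qed.

(** Below the girth a chain behaves like a path in a tree: parity puts its leaves at [x] or [y], and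
    if the leaf found is [x] its edge is removed and [x] moves one step. *)
Lemma short_chain Z x y : genuine Z -> #|Z| < n -> boundary Z x y ->
  #|star Z y| <= 1 /\ (x = y -> Z = finset.set0).
Proof.
have closed Z' z : genuine Z' -> #|Z'| < n -> boundary Z' z z -> Z' = finset.set0.
  move=> gZ Zn bZ; apply/eqP; apply: contrapT => /negP Z0.
  have [t t1] := leaf_exists gZ Z0 Zn.
  by have := boundaryP t bZ; rewrite t1 addbb.
move=> gZ Zn bZ; split; last by move=> xy; move: bZ; rewrite xy; apply: closed.
elim: {Z}#|Z| {-2}Z (erefl #|Z|) x gZ Zn bZ => [|m IH] Z Zm x gZ Zn bZ.
  move/eqP: Zm; rewrite cards_eq0 => /eqP->.
  by have -> : star finset.set0 y = finset.set0;
    [apply/setP => a; rewrite !inE|rewrite cards0].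
have Z0 : Z != finset.set0 by rewrite -card_gt0 Zm.
have [t t1] := leaf_exists gZ Z0 Zn.
have [ty|ty] := eqVneq t y; first by rewrite -ty t1.
have tx : t = x.
  by have := boundaryP t bZ; rewrite t1 (negPf ty) addbF => /esym/eqP.
subst t; have /cards1P[a sa] : #|star Z x| == 1 by rewrite t1.
have aZ : half_edges x a \in Z.
  have : a \in star Z x by rewrite sa inE.
  by rewrite inE.
pose Z' := sdiff [set half_edges x a] Z.
have Z'E : Z' = Z :\ half_edges x a.
  by apply/setP => e; rewrite in_sdiff !inE; case: eqP => [->|//]; rewrite aZ.
have Z'm : #|Z'| = m by move: Zm; rewrite (cardsD1 (half_edges x a) Z) aZ Z'E => -[].
have gZ' : genuine Z' by apply: genuine_sdiff => //; apply: genuine1.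
have bZ' : boundary Z' (mv x a) y.
  by apply: boundary_sdiff bZ; rewrite boundaryC; apply: boundary1.
have Z'n : #|Z'| < n by rewrite Z'm; apply: leq_trans Zn; rewrite Zm.
have Z'y := IH Z' Z'm (mv x a) gZ' Z'n bZ'.
have -> : Z = sdiff [set half_edges x a] Z' by rewrite sdiffK.
rewrite star_sdiff star1 (negPf (_ : y != x)) 1?eq_sym//=.
have [ymv|ymv] := eqVneq y (mv x a); last by rewrite sdiffC sdiff0.
have -> : Z' = finset.set0 by apply: (closed _ y) => //; rewrite {1}ymv.
have -> : star finset.set0 y = finset.set0 by apply/setP => b; rewrite !inE.
by rewrite sdiff0 cards1.
Qed.

Local Notation point := ({set edgeT} * X)%type.
Implicit Types (p q : point) (T : {set point}).

(** A point of the cover above [p.2]: paths from [x0] that use the same edges mod 2 are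
    identified. *)
Definition chain p := genuine p.1 && boundary p.1 x0 p.2.
Definition neighbour p a : point := (sdiff p.1 [set half_edges p.2 a], mv p.2 a).
Definition hamming p q := #|sdiff p.1 q.1|.

Lemma chain_neighbour p a : chain p -> chain (neighbour p a).
Proof.
move=> /andP[gp bp]; rewrite /chain /= genuine_sdiff ?genuine1//=.
exact: boundary_sdiff bp (boundary1 _ _).
Qed.

Lemma neighbourK p a : neighbour (neighbour p a) a = p.
Proof.
case: p => c x; rewrite /neighbour /= half_edgesK mvK; congr (_, _).
by rewrite -sdiffA sdiffv sdiff0.
Qed.

Lemma hamming_neighbour p a : hamming p (neighbour p a) = 1.
Proof. by rewrite /hamming /= sdiffK cards1. Qed.

Lemma chain_sdiff p q : chain p -> chain q ->
  genuine (sdiff p.1 q.1) /\ boundary (sdiff p.1 q.1) p.2 q.2.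
Proof.
move=> /andP[gp bp] /andP[gq bq]; split; first exact: genuine_sdiff.
by apply: boundary_sdiff bq; rewrite boundaryC.
Qed.

Lemma hamming_eq0 p q : chain p -> chain q -> hamming p q = 0 -> p = q.
Proof.
move=> cp cq /eqP; rewrite cards_eq0 => /eqP pq0.
have [_] := chain_sdiff cp cq; rewrite pq0 => /(boundaryP p.2).
have -> : star finset.set0 p.2 = finset.set0 by apply/setP => b; rewrite !inE.
rewrite cards0 eqxx /= => /esym/negbFE/eqP p2.
have p1 : p.1 = q.1 by rewrite -[RHS](sdiffK p.1) pq0 sdiff0.
by move: p1 p2; case: (p) (q) => [? ?] [? ?] /= -> ->.
Qed.

(** An edge of the difference at the end of [q] leads one step closer to [p], so each radius adds at
    most three neighbours per point; 4 is one plus three. *)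
Lemma ball_chain k p : k < n -> chain p ->
  exists2 F : {set point}, #|F| <= 4 ^ k
    & forall q, chain q -> hamming p q <= k -> q \in F.
Proof.
move=> + cp; elim: k => [|k IH] kn.
  exists [set p]; first by rewrite cards1.
  by move=> q cq; rewrite leqn0 => /eqP/(hamming_eq0 cp cq) <-; rewrite inE.
have [F F4 hF] := IH (ltnW kn).
exists (F :|: [set neighbour u.1 u.2 | u in finset.setX F [set: 'I_3]]).
  rewrite cardsU; apply: leq_trans (leq_subr _ _) _.
  rewrite expnS mulSn; apply: leq_add => //; apply: leq_trans (leq_imset_card _ _) _.
  by rewrite cardsX cardsT card_ord mulnC leq_mul2l.
move=> q cq pqk; have [gZ bZ] := chain_sdiff cp cq.
rewrite finset.in_setU; have [pq0|pq0] := posnP (hamming p q).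
  by rewrite hF// pq0.
have Zn : #|sdiff p.1 q.1| < n by apply: leq_ltn_trans kn.
have [_ pq2] := short_chain gZ Zn bZ.
have /card_gt0P[a] : 0 < #|star (sdiff p.1 q.1) q.2|.
  have := boundaryP q.2 bZ; rewrite eqxx addbT.
  case: (eqVneq q.2 p.2) => [qp|_ /=]; last by case: #|_|.
  by move: pq0; rewrite /hamming pq2 ?cards0.
rewrite inE => aZ; apply/orP; right; apply/imsetP.
exists (neighbour q a, a); last by rewrite /= neighbourK.
rewrite finset.in_setX finset.in_setT andbT; apply: hF; first exact: chain_neighbour.
rewrite /hamming /= sdiffA -ltnS; apply: leq_trans pqk; rewrite /hamming.
rewrite [leqRHS](cardsD1 (half_edges q.2 a)) aZ add1n ltnS; apply: subset_leq_card.
apply/fintype.subsetP => e; rewrite in_sdiff [e \in [set _]]inE finset.in_setD1.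
by case: eqP => [->|_]; rewrite ?aZ ?addbF.
Qed.

(* Relative to a base point of [T], each vertex has at most one neighbour in
   [T] that is closer to it, so [T] spans at most #|T| edges. *)
Lemma edge_boundary T : {in T, forall p, chain p} ->
  {in T &, forall p q, hamming p q < n} ->
  #|T| <= #|[set u : point * 'I_3 | (u.1 \in T) && (neighbour u.1 u.2 \notin T)]|.
Proof.
move=> Tc Tn; have [->|/set0Pn[y yT]] := eqVneq T finset.set0; first by rewrite cards0.
pose back (u : point * 'I_3) := half_edges u.1.2 u.2 \in sdiff y.1 u.1.1.
pose inner (u : point * 'I_3) := (u.1 \in T) && (neighbour u.1 u.2 \in T).
pose Lo := [set u | inner u && back u]; pose Up := [set u | inner u && ~~ back u].
set Out := finset _.
have LoT : #|Lo| <= #|T|.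
  rewrite -(card_in_imset (f := fst) (D := mem Lo)).
    apply: subset_leq_card; apply/fintype.subsetP => p /imsetP[u].
    by rewrite inE => /andP[/andP[uT _] _] ->.
  move=> [p a] [p' b] /=; rewrite !inE /back /= => /andP[/andP[/= pT _] pa].
  move=> /andP[_ pb] pp'; subst p'; congr (_, _).
  have [gZ bZ] := chain_sdiff (Tc _ yT) (Tc _ pT).
  have [star1 _] := short_chain gZ (Tn _ _ yT pT) bZ.
  by have /card_le1_eqP := star1; apply; rewrite inE.
(* Reversing an edge that leads away from [y] gives one that leads back. *)
have UpLo : #|Up| <= #|Lo|.
  have inj : injective (fun u : point * 'I_3 => (neighbour u.1 u.2, u.2)).
    move=> [p a] [p' b] /= [c1 m1 ab]; rewrite ab in c1 m1 *.
    by rewrite -(neighbourK p b) /neighbour /= c1 m1 [X in (X, _)](neighbourK p' b).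
  rewrite -(card_imset _ inj); apply: subset_leq_card.
  apply/fintype.subsetP => _ /imsetP[[p a] + ->].
  rewrite !inE /inner /back /= neighbourK half_edgesK => /andP[/andP[-> ->]] /=.
  by rewrite !in_sdiff inE eqxx addbT addbN.
(* Of the three edges at every point of [T], counted with direction, at most [2 * #|T|] stay
   inside. *)
have : #|T| * 3 <= #|Out| + (#|Lo| + #|Up|).
  apply: (@leq_trans #|Out :|: (Lo :|: Up)|).
    have <- : #|finset.setX T [set: 'I_3]| = #|T| * 3.
      by rewrite cardsX cardsT card_ord.
    apply: subset_leq_card.
    apply/fintype.subsetP => u; rewrite !inE andbT /inner => ->.
    by case: (_ \in T) => //=; case: (back u).
  rewrite cardsU; apply: leq_trans (leq_subr _ _) _; rewrite leq_add2l cardsU.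
  exact: leq_subr.
move: LoT UpLo; clear; move: #|T| #|Out| #|Lo| #|Up| => t o l u; lia.
Qed.

Lemma sum_mem_fset (T : choiceType) (U B : {fset T}) : (B `<=` U)%fset ->
  \sum_(t <- U) (t \in B : nat) = #|` B|.
Proof.
move=> BU; rewrite (eq_bigr (fun t => if t \in B then 1 else 0)); last first.
  by move=> t _; case: (t \in B).
rewrite -big_mkcond sum1_count -size_filter; apply: perm_size; apply: uniq_perm.
- by rewrite filter_uniq.
- exact: fset_uniq.
- move=> t; rewrite mem_filter andb_idr //; exact: (fsubsetP BU).
Qed.

Lemma chain0 : chain (finset.set0, x0).
Proof.
apply/andP; split; first by apply/forallP => e; rewrite !inE.
apply/forallP => z; rewrite addbb.
have -> : star finset.set0 z = finset.set0 by apply/setP => b; rewrite !inE.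
by rewrite cards0.
Qed.

(** Double counting: grouped by [t], the losses [A p \ A (neighbour p a)] count the boundary edges
    of the sets of points [p] with [t] in [A p], so by [edge_boundary] they total at least the sum
    of all [#|A p|]. Three losses below a third each give less. *)
Lemma no_almost_invariant (K : choiceType) (A : point -> {fset K}) :
  (forall p q t, chain p -> chain q -> t \in A p -> t \in A q -> hamming p q < n) ->
  (forall p a, chain p -> 3 * #|` A p `\` A (neighbour p a)| < #|` A p|) -> False.
Proof.
move=> An Ainv; pose U := (\bigcup_(p <- enum [set p | chain p]) A p)%fset.
have AU p : chain p -> (A p `<=` U)%fset.
  move=> cp; apply/fsubsetP => t tA; apply/bigfcupP; exists p => //.
  by rewrite mem_enum inE cp.
pose out t (u : point * 'I_3) := t \in (A u.1 `\` A (neighbour u.1 u.2))%fset.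
have lower : \sum_(p | chain p) #|` A p| <=
    \sum_(p | chain p) \sum_a #|` A p `\` A (neighbour p a)|.
  rewrite (eq_bigr (fun p => \sum_(t <- U) (t \in A p : nat))); last first.
    by move=> p cp; rewrite sum_mem_fset// AU.
  rewrite exchange_big pair_big /=.
  rewrite [leqRHS](eq_bigr (fun u => \sum_(t <- U) (out t u : nat))); last first.
    move=> u; rewrite andbT => cu; rewrite sum_mem_fset//.
    by apply: fsubset_trans (AU _ cu); apply: fsubsetDl.
  rewrite [leqRHS]exchange_big; apply: leq_sum => t _.
  pose T := [set p | chain p && (t \in A p)].
  have -> : \sum_(p | chain p) (t \in A p : nat) = #|T|.
    rewrite -sum1_card big_mkcond [RHS]big_mkcond; apply: eq_bigr => p _.
    by rewrite inE; case: (chain p); case: (t \in A p).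
  apply: leq_trans (edge_boundary (T := T) _ _) _.
  - by move=> p; rewrite inE => /andP[].
  - move=> p q; rewrite !inE => /andP[cp tp] /andP[cq tq]; exact: An tp tq.
  rewrite -sum1_card big_mkcond [leqRHS]big_mkcond; apply: leq_sum => u _.
  rewrite !inE andbT /out in_fsetD; case: (boolP (chain u.1)) => //= cu.
  by rewrite (chain_neighbour _ cu) andbC.
suff : \sum_(p | chain p) #|` A p| >
    \sum_(p | chain p) \sum_a #|` A p `\` A (neighbour p a)|.
  by rewrite ltnNge lower.
have small p : chain p -> \sum_a #|` A p `\` A (neighbour p a)| < #|` A p|.
  move=> cp; rewrite !big_ord_recl big_ord0 addn0.
  have := Ainv p ord0 cp; have := Ainv p (lift ord0 ord0) cp.
  have := Ainv p (lift ord0 (lift ord0 ord0)) cp.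
  move: #|` _| #|` _| #|` _| #|` _| => a b c d; lia.
(* Strictness of the sum needs one term, supplied by the empty chain. *)
rewrite (bigD1 _ chain0) [ltnRHS](bigD1 _ chain0) /= -addSn.
apply: leq_add; first exact: small chain0.
by apply: leq_sum => p /andP[cp _]; apply: ltnW; apply: small.
Qed.

End Cover.

(** * The homology cover inside a cube *)

Section Piece.
Local Open Scope ring_scope.
Import Order.TTheory GRing.Theory Num.Theory.

(* [Y] is the Z/2-homology cover of a 3-regular graph of large girth, realised
   inside a cube. *)
Lemma cube_piece (n : nat) : (0 < n)%N -> exists I : finType,
  forall (R : realType) (M : metricType R) (r : nat) (phi : {set I} -> M),
  (forall c d, #|sdiff c d|%:R <= mdist (phi c) (phi d)) ->
  (forall c d, mdist (phi c) (phi d) <= (r * #|sdiff c d|)%:R) ->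
  exists Y : {fset M}, [/\ forall y, y \in Y -> exists c, y = phi c,
    forall k x, (k < n)%N -> x \in Y -> exists2 F : {fset M}, (#|` F| <= 4 ^ k)%N
      & forall y, y \in Y -> mdist x y <= k%:R -> y \in F
    & forall (A : M -> {fset M * nat}) (S : R), S *+ 2 <= n%:R ->
      (forall x p, x \in Y -> p \in A x -> mdist x p.1 < S) ->
      (forall x y, x \in Y -> y \in Y -> mdist x y <= r%:R ->
        (A x `&` A y)%fset <> fset0 /\
        #|` fsymdiff (A x) (A y)|%:R / #|` A x `&` A y|%:R < 3^-1 :> R) -> False].
Proof.
move=> n0; have [X [mv [[x0] mvK girth]]] := large_girth_graph n.
exists {set X * 'I_3} => R M r phi lo up.
(* Only the chain [p.1] enters [phi]; by [hamming_eq0] it determines the end point. *)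
pose C := [set p | chain mv x0 p].
have inC p : (p \in C) = chain mv x0 p by rewrite inE.
exists [fset phi p.1 | p in C]%fset; split.
- by move=> _ /imfsetP[p _ ->]; exists p.1.
- move=> k _ kn /imfsetP[p /= pC ->]; rewrite inC in pC.
  have [F F4 hF] := ball_chain n0 mvK girth kn pC.
  exists [fset phi p.1 | p in F]%fset.
    by apply: leq_trans (leq_imfset_card _ _ _) _; rewrite /= -cardE.
  move=> _ /imfsetP[q /= qC ->] pq; apply/imfsetP; exists q => //=.
  rewrite inC in qC; rewrite hF// -(ler_nat R); exact: le_trans (lo _ _) pq.
- move=> A S Sn AS Ainv.
  have inY p : chain mv x0 p -> phi p.1 \in [fset phi p.1 | p in C]%fset.
    by move=> cp; apply/imfsetP; exists p; rewrite //= inC.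
  apply: (no_almost_invariant n0 mvK girth (x0 := x0) (A := fun p => A (phi p.1))).
    (* A common element lies within [S] of both images, so the two points are at distance less than
       [S *+ 2]. *)
    move=> p q t /inY pY /inY qY tp tq; rewrite -(ltr_nat R).
    apply: le_lt_trans (lo _ _) _; apply: lt_le_trans Sn; rewrite mulr2n.
    apply: le_lt_trans (metric_triangle _ t.1 _) _; apply: ltrD; first exact: AS.
    by rewrite metric_sym; apply: AS.
  move=> p a cp; have cq := chain_neighbour n0 mvK girth a cp.
  have [|/eqP I0] := Ainv _ _ (inY _ cp) (inY _ cq).
    apply: le_trans (up _ _) _; rewrite ler_nat.
    by have := hamming_neighbour mv p a; rewrite /hamming => ->; rewrite muln1.
  rewrite -cardfs_gt0 in I0; rewrite ltr_pdivrMr ?ltr0n// ltr_pdivlMl// => lt3.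
  apply: (@leq_ltn_trans (3 * #|` fsymdiff (A (phi p.1)) (A (phi (neighbour mv p a).1))|)).
    rewrite leq_mul2l /=; apply: fsubset_leq_card; exact: fsubsetUl.
  rewrite -(ltr_nat R) natrM; apply: lt_le_trans lt3 _.
  by rewrite ler_nat; apply: fsubset_leq_card; apply: fsubsetIl.
Qed.

End Piece.

(** * Cubes in the path space *)

Section Family.
Variables (I : finType) (E : choiceType) (K : I -> {fset E}).
Hypothesis K_neq0 : forall i, K i != fset0.
Hypothesis K_disjoint : forall i j e, e \in K i -> e \in K j -> i = j.

Definition family_union (S : {set I}) := (\bigcup_(i <- enum S) K i)%fset.

Lemma in_family_union i S e : e \in K i -> (e \in family_union S) = (i \in S).
Proof.
move=> eK; apply/bigfcupP/idP => [[j]|iS].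
  by rewrite mem_enum andbT => jS /(K_disjoint eK) ->.
by exists i; rewrite ?mem_enum ?iS.
Qed.

Lemma fsymdiff_family_union (S S' : {set I}) :
  fsymdiff (family_union S) (family_union S') = family_union (sdiff S S').
Proof.
apply/fsetP => e; rewrite in_fsymdiff.
have [[i eK]|no] := pselect (exists i, e \in K i).
  by rewrite !(in_family_union _ eK) in_sdiff.
have none T : (e \in family_union T) = false.
  by apply/negP => /bigfcupP[i _ eK]; apply: no; exists i.
by rewrite !none.
Qed.

Lemma leq_card_family_union (S : {set I}) : (#|S| <= #|` family_union S|)%N.
Proof.
have /choice [e eP] : forall i, exists e, e \in K i by move=> i; apply/fset0Pn.
have inj : injective e.
  by move=> i j eij; apply: K_disjoint (eP i) _; rewrite eij.
apply: (@leq_trans #|` [fset e i | i in S]|).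
  by rewrite card_imfset//= -cardE.
apply: fsubset_leq_card; apply/fsubsetP => _ /imfsetP[i /= iS ->].
by rewrite (in_family_union _ (eP i)).
Qed.

Lemma card_family_union_leq r (S : {set I}) : (forall i, #|` K i| <= r)%N ->
  (#|` family_union S| <= r * #|S|)%N.
Proof. by move=> Kr; rewrite cardE mulnC; exact: card_bigfcup_seq. Qed.

End Family.

Lemma fsymdiff_cancel (T : choiceType) (A B C : {fset T}) :
  fsymdiff (fsymdiff A B) (fsymdiff A C) = fsymdiff B C.
Proof.
apply/fsetP => t; rewrite !in_fsymdiff.
by case: (t \in A); case: (t \in B); case: (t \in C).
Qed.

(** * Pieces chosen far apart *)

Section Separated.
Local Open Scope ring_scope.
Import Order.TTheory GRing.Theory Num.Theory.

(** Each piece is chosen far from [past n], the finite union of all earlier ones. *)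
Lemma separated_sequence (R : realType) (X : metricType R)
    (Q : nat -> {fset X} -> Prop) :
  (forall n (F : {fset X}), exists Y : {fset X}, Q n Y /\
    forall x y, x \in F -> y \in Y -> n%:R < mdist x y) ->
  exists Y : nat -> {fset X}, (forall n, Q n (Y n)) /\
    forall m n x y, (m < n)%N -> x \in Y m -> y \in Y n -> n%:R < mdist x y.
Proof.
move=> h; have /choice [f fP] : forall nF : nat * {fset X}, exists Y : {fset X},
    Q nF.1 Y /\ forall x y, x \in nF.2 -> y \in Y -> nF.1%:R < mdist x y.
  by move=> [n F]; exact: h.
pose past := fix past n : {fset X} :=
  if n is m.+1 then (past m `|` f (m, past m))%fset else fset0.
exists (fun n => f (n, past n)); split=> [n|m n x y mn xm yn].
  by have [] := fP (n, past n).
have [_] := fP (n, past n); apply=> //=.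
elim: n mn {yn} => // n IH; rewrite ltnS leq_eqVlt in_fsetU => /orP[/eqP <-|mn].
  by rewrite xm orbT.
by rewrite IH.
Qed.

End Separated.

(** * The space of simple paths *)

Section PathSpace.
Local Open Scope ring_scope.
Import Order.TTheory GRing.Theory Num.Theory.
Variables (R : realType) (G : multigraph) (root : vertex G).
Variable D : path_space_data R root.
Hypothesis ccG : controlled_cycles G.
Hypothesis degG : bounded_degree G.
Local Notation V := (vertex G).
Local Notation X := (path_space D).

Definition path_point (v : V) (p : simple_path root v) : X :=
  Tagged (fun w => path_component R root w : Type) (p : path_component R root v).

Lemma path_pointP (x : X) : exists v (p : simple_path root v), x = path_point p.
Proof. by case: x => v p; exists v, p. Qed.

Lemma mdist_path_point v (p q : simple_path root v) :
  mdist (path_point p) (path_point q) = #|` fsymdiff (edges p) (edges q)|%:R.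
Proof. exact: cdu_dist_same. Qed.

Lemma mdist_path_point_neq v w (p : simple_path root v) (q : simple_path root w) :
  v != w -> mdist (path_point p) (path_point q) =
    mdist (p : path_component R root v) (cdu_base D v) +
    mdist (q : path_component R root w) (cdu_base D w) + cdu_alpha D v w.
Proof. exact: cdu_dist_diff. Qed.

Lemma spath_edges v (p : simple_path root v) : exists W, spath root v (edges p) W.
Proof. by apply/simple_pathP; case: p => A sA; exact: set_mem sA. Qed.

Lemma simple_path_of v A W : spath root v A W ->
  exists p : simple_path root v, edges p = A.
Proof.
move=> p; have sA : is_simple_path root v A by apply/simple_pathP; exists W.
by exists (exist _ A (mem_set sA)).
Qed.

Lemma real_le_nat (K : R) : exists k : nat, K <= k%:R.
Proof.
exists (Num.bound `|K|); apply: le_trans (ler_norm _) _.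
exact/ltW/archi_boundP.
Qed.

Lemma paths_within v (p : simple_path root v) (Om : {fset edge G}) :
  exists2 F : {fset X}, (#|` F| <= 2 ^ #|` Om|)%N
    & forall q : simple_path root v,
        (fsymdiff (edges p) (edges q) `<=` Om)%fset -> path_point q \in F.
Proof.
(* A path is recovered from its difference with [p], a subset of [Om]. Subsets that give no path are
   sent to [p]. *)
pose f (M : {fset edge G}) : X :=
  if pselect (exists q : simple_path root v, edges q = fsymdiff (edges p) M)
  is left h then path_point (sval (cid h)) else path_point p.
exists [fset f M | M in fpowerset Om]%fset.
  by apply: leq_trans (leq_imfset_card _ _ _) _; rewrite /= card_fpowerset.
move=> q qOm; apply/imfsetP; exists (fsymdiff (edges p) (edges q)).
  by rewrite /= fpowersetE.
rewrite /f; case: pselect => [h|[]]; last by exists q; rewrite fsymdiffK.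
congr path_point; apply: val_inj; case: (cid h) => /= q' q'E.
by rewrite -[RHS]/(edges q') q'E fsymdiffK.
Qed.

Lemma component_locally_finite v (p : simple_path root v) (K : R) :
  exists F : {fset X}, forall q : simple_path root v,
    mdist (path_point p) (path_point q) <= K -> path_point q \in F.
Proof.
have [k Kk] := real_le_nat K; have [W pW] := spath_edges p.
have [Om hOm] := locally_finite_paths ccG degG k pW.
have [F _ hF] := paths_within p Om; exists F => q.
rewrite mdist_path_point => pq; have [W' qW] := spath_edges q.
apply: hF; apply: hOm qW _; rewrite -(ler_nat R); exact: le_trans pq Kk.
Qed.

(** Only finitely many pairs have [cdu_alpha] at most [K], and [q] then lies in the [K]-ball around
    the base point of its component, which is finite. The same finite set serves all [p]. *)
Lemma other_components_finite (K : R) : exists F : {fset X},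
  forall v w (p : simple_path root v) (q : simple_path root w), v != w ->
    mdist (path_point p) (path_point q) <= K -> path_point q \in F.
Proof.
have fin := cdu_alpha_lim D K; set P := (X in finite_set X) in fin.
have /choice [F hF] : forall w : V, exists F : {fset X},
    forall q : simple_path root w,
      mdist (path_point (cdu_base D w)) (path_point q) <= K -> path_point q \in F.
  by move=> w; exact: component_locally_finite.
exists (\bigcup_(vw <- fset_set P) F vw.2)%fset => v w p q vw.
rewrite mdist_path_point_neq// => pqK; apply/bigfcupP; exists (v, w).
  rewrite andbT in_fset_set// mem_set//; split=> //=; apply: le_trans pqK.
  by rewrite lerDr addr_ge0// mdist_ge0.
apply: hF; rewrite metric_sym; apply: le_trans pqK.
rewrite -[X in X <= _]add0r -addrA; apply: lerD; first exact: mdist_ge0.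
by rewrite [mdist _ _]cdu_dist_same lerDl ltW// cdu_alpha_gt0.
Qed.

Lemma path_space_locally_finite (x : X) (K : R) :
  exists F : {fset X}, forall y, mdist x y <= K -> y \in F.
Proof.
have [v [p ->]] := path_pointP x.
have [F1 h1] := component_locally_finite p K.
have [F2 h2] := other_components_finite K.
exists (F1 `|` F2)%fset => y; have [w [q ->]] := path_pointP y.
rewrite in_fsetU; have [vw|vw] := eqVneq v w.
  by case: w / vw q => q /h1 ->.
by move=> /(h2 _ _ _ _ vw) ->; rewrite orbT.
Qed.

(** Points outside the component of the centre lie in the fixed finite set [F1], so large balls are
    already large within one component. *)
Lemma unbounded_component_balls : ~ bounded_geometry [set: X]%classic ->
  exists2 r : nat, (0 < r)%N & forall C : nat, exists v (p : simple_path root v),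
    forall F : {fset X}, (forall q : simple_path root v,
      (#|` fsymdiff (edges p) (edges q)| <= r)%N -> path_point q \in F) ->
    (C < #|` F|)%N.
Proof.
move=> /existsNP[r0 /not_implyP[r0_gt0 /forallNP nC]].
have [r r0r] := real_le_nat r0; have [F1 h1] := other_components_finite r0.
exists r; first by rewrite -(ltr_nat R); apply: lt_le_trans r0r.
move=> C; have /existsNP[x] := nC (C + #|` F1|)%N.
move=> /not_implyP[_ nball]; have [v [p xp]] := path_pointP x.
exists v, p => F hF; rewrite ltnNge; apply/negP => FC; apply: nball.
apply/card_le_fsetP; exists (F `|` F1)%fset.
  by rewrite cardfsU; apply: leq_trans (leq_subr _ _) _; rewrite leq_add2r.
move=> y [+ _]; rewrite ballEmdist xp /= => /ltW xy.
have [w [q yq]] := path_pointP y; rewrite {}yq in xy *; rewrite in_fsetU.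
have [vw|vw] := eqVneq v w; last by rewrite (h1 _ _ _ _ vw xy) orbT.
case: w / vw q xy => q; rewrite mdist_path_point => pq.
by rewrite hF// -(ler_nat R); apply: le_trans pq r0r.
Qed.

(** A ball with more than [2 ^ c] points excludes the second case of [switches_or_few_paths], and
    the disjoint switches are the coordinates. The last clause lets the position of [p] control that
    of the whole cube. *)
Lemma cube_in_path_space (I : finType) (r : nat) : exists C : nat,
  forall v (p : simple_path root v),
  (forall F : {fset X}, (forall q : simple_path root v,
    (#|` fsymdiff (edges p) (edges q)| <= r)%N -> path_point q \in F) ->
    (C < #|` F|)%N) ->
  exists phi : {set I} -> X,
    [/\ forall S T, #|sdiff S T|%:R <= mdist (phi S) (phi T),
        forall S T, mdist (phi S) (phi T) <= (r * #|sdiff S T|)%:R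
      & forall S, mdist (path_point p) (phi S) <= (r * #|I|)%:R].
Proof.
have [c hc] := switches_or_few_paths ccG degG #|I| r; exists (2 ^ c)%N => v p pC.
have [W pW] := spath_edges p.
have [[K [Ksw Kdis]]|[Om Omc hOm]] := hc _ _ _ _ pW; last first.
  have [F F2 hF] := paths_within p Om.
  have := pC F; rewrite ltnNge (leq_trans F2) ?leq_exp2l//; case/(_ _)/negP => //.
  by move=> q pq; apply: hF; have [W' qW] := spath_edges q; apply: hOm qW pq.
pose K' (i : I) := K (enum_rank i).
have dis (i j : I) : i != j -> (vset (K' i) `&` vset (K' j))%fset = fset0.
  by move=> ij; apply: Kdis => //; rewrite (inj_eq val_inj) (inj_eq enum_rank_inj).
have K'sw i : local_switch r root v (edges p) (K' i) by apply: Ksw.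
have K'0 i : K' i != fset0 by have [] := K'sw i.
have K'r i : (#|` K' i| <= r)%N by have [] := K'sw i.
have K'd i j e : e \in K' i -> e \in K' j -> i = j.
  move=> eKi eKj; apply/eqP; apply: contraT => ij.
  have [x xe] := ends_inhabited e.
  by move/fsetP/(_ x): (dis _ _ ij); rewrite !inE (mem_vset eKi xe) (mem_vset eKj xe).
have /choice [f hf] : forall S : {set I}, exists q : simple_path root v,
    edges q = fsymdiff (edges p) (family_union K' S).
  move=> S; have [||||W' qW] := spath_switch_family ccG (K := K') (s := enum S) pW.
  - exact: enum_uniq.
  - by move=> i _; have [] := K'sw i.
  - by move=> i; have [] := K'sw i.
  - exact: dis.
  - exact: simple_path_of qW.
have df S T : mdist (path_point (f S) : X) (path_point (f T)) =
    #|` family_union K' (sdiff S T)|%:R.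
  by rewrite mdist_path_point !hf fsymdiff_cancel fsymdiff_family_union.
exists (fun S => path_point (f S)); split=> S.
- by move=> T; rewrite df ler_nat leq_card_family_union.
- by move=> T; rewrite df ler_nat card_family_union_leq.
- rewrite mdist_path_point hf fsymdiffK ler_nat.
  apply: leq_trans (card_family_union_leq _ K'r) _.
  by rewrite leq_mul2l max_card orbT.
Qed.

(** The obstruction at stage [n]: tree-like balls up to radius [n], and no witness of property A
    with supports of radius at most [n / 2]. The scale [r] and the tolerance 1/3 do not vary with
    [n]. *)
Definition bad_piece (r n : nat) (Y : {fset X}) :=
  (forall k x, (k <= n)%N -> x \in Y -> exists2 F : {fset X}, (#|` F| <= 4 ^ k)%N
    & forall y, y \in Y -> mdist x y <= k%:R -> y \in F) /\
  (forall (A : X -> {fset X * nat}) (S : R), S *+ 2 <= n%:R ->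
    (forall x p, x \in Y -> p \in A x -> mdist x p.1 < S) ->
    (forall x y, x \in Y -> y \in Y -> mdist x y <= r%:R ->
      (A x `&` A y)%fset <> fset0 /\
      #|` fsymdiff (A x) (A y)|%:R / #|` A x `&` A y|%:R < 3^-1 :> R) -> False).

(** The finite set [BF] contains all points within [n + r * #|I|] of [F]. The centre [p] has an
    [r]-ball larger than that of any point of [BF], so it lies outside, and a piece within
    [r * #|I|] of [p] is farther than [n] from [F]. *)
Lemma bad_piece_far (r : nat) :
  (forall C : nat, exists v (p : simple_path root v),
    forall F : {fset X}, (forall q : simple_path root v,
      (#|` fsymdiff (edges p) (edges q)| <= r)%N -> path_point q \in F) ->
    (C < #|` F|)%N) ->
  forall n (F : {fset X}), exists Y : {fset X}, bad_piece r n Y /\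
    forall x y, x \in F -> y \in Y -> n%:R < mdist x y.
Proof.
(* The girth parameter [n.+1] is positive even for [n = 0], and admits radii up to [n] itself. *)
move=> big n F; have [I hI] := cube_piece (ltn0Sn n).
have [C hC] := cube_in_path_space I r.
have /choice [B hB] : forall x : X, exists B : {fset X},
    forall y, mdist x y <= (n + r * #|I|)%:R -> y \in B.
  by move=> x; exact: path_space_locally_finite.
have /choice [N hN] : forall x : X, exists N : {fset X},
    forall y, mdist x y <= r%:R -> y \in N.
  by move=> x; exact: path_space_locally_finite.
pose BF := (\bigcup_(x <- F) B x)%fset.
have [v [p pC]] := big (maxn C (\max_(x <- BF) #|` N x|)).
have [|phi [lo up near]] := hC v p.
  by move=> N' /pC; rewrite gtn_max => /andP[].
have [Y [Yphi Ygeom YnA]] := hI R X r phi lo up.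
exists Y; split.
  split=> [k x kn|A S Sn]; first exact: Ygeom.
  by apply: YnA; apply: le_trans Sn _; rewrite ler_nat.
move=> x y xF yY; rewrite ltNge; apply/negP => xy.
have pBF : path_point p \in BF.
  apply/bigfcupP; exists x; first by rewrite xF.
  apply: hB; rewrite natrD; apply: le_trans (metric_triangle _ y _) _.
  apply: lerD => //; have [S ->] := Yphi _ yY; by rewrite metric_sym.
have : (\max_(x <- BF) #|` N x| < #|` N (path_point p)|)%N.
  apply: leq_ltn_trans (pC _ _); first exact: leq_maxr.
  by move=> q pq; apply: hN; rewrite mdist_path_point ler_nat.
by rewrite ltnNge (leq_bigmax_seq (F := fun x => #|` N x|)).
Qed.

(** A ball of radius at most [k] centred in a piece of index at least [k] stays in that piece and
    has at most [4 ^ k] points; one centred in an earlier piece stays in the finite union [small]. A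
    witness of property A with radius [S] is refuted on any piece whose index is at least
    [S *+ 2]. *)
Lemma bounded_geometry_without_property_A :
  ~ bounded_geometry [set: X]%classic ->
  exists Y : set X, bounded_geometry Y /\ ~ property_A Y.
Proof.
move=> /unbounded_component_balls[r r0 big].
have [Y [Ybad Yfar]] := separated_sequence (bad_piece_far big).
exists [set x | exists n, x \in Y n]%classic; split.
  move=> r1 _; have [k r1k] := real_le_nat r1.
  have Yfar' m n x y : (m != n)%N -> x \in Y m -> y \in Y n ->
      (maxn m n)%:R < mdist x y.
    rewrite neq_ltn => /orP[mn|nm] xm yn.
      by rewrite (maxn_idPr (ltnW mn)); apply: Yfar mn xm yn.
    by rewrite (maxn_idPl (ltnW nm)) metric_sym; apply: Yfar nm yn xm.
  pose small := (\bigcup_(m <- iota 0 k) Y m)%fset.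
  exists (4 ^ k + #|` small|)%N => x [m xm]; apply/card_le_fsetP.
  have [mk|km] := ltnP m k.
    exists small; first exact: leq_addl.
    move=> y []; rewrite ballEmdist /= => xy [j yj].
    have [jk|kj] := ltnP j k.
      by apply/bigfcupP; exists j; rewrite ?mem_iota ?jk.
    have mj : m != j by rewrite neq_ltn (leq_trans mk kj).
    have := Yfar' _ _ _ _ mj xm yj; rewrite ltNge => /negP[]; apply: ltW.
    apply: lt_le_trans xy _; apply: le_trans r1k _.
    by rewrite ler_nat leq_max kj orbT.
  have [geom _] := Ybad m; have [F F4 hF] := geom _ _ km xm.
  exists F; first by apply: leq_trans F4 (leq_addr _ _).
  move=> y []; rewrite ballEmdist /= => xy [j yj].
  have xyk : mdist x y <= k%:R by apply/ltW/(lt_le_trans xy).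
  have [mj|mj] := eqVneq m j; first by apply: hF; rewrite ?mj.
  have := Yfar' _ _ _ _ mj xm yj; rewrite ltNge => /negP[].
  by apply: le_trans xyk _; rewrite ler_nat leq_max km.
move=> YA; have r_gt0 : 0 < r%:R :> R by rewrite ltr0n.
have third_gt0 : 0 < 3^-1 :> R by rewrite invr_gt0 ltr0n.
have [S [A [_ _ AS Ainv]]] := YA _ _ r_gt0 third_gt0.
have [n Sn] := real_le_nat (S *+ 2); have [_] := Ybad n.
move=> /(_ A S Sn); apply.
- move=> x p xn pA; have [_] := AS x (ex_intro _ n xn) p pA.
  by rewrite ballEmdist.
- by move=> x y xn yn xy; apply: Ainv => //; exists n.
Qed.

End PathSpace.

Local Open Scope classical_set_scope.

Theorem theorem12 (R : realType) (G : multigraph) (root : vertex G)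
  (countV : countable [set: vertex G])
  (connG : connected_graph G)
  (ccG : controlled_cycles G)
  (degG : bounded_degree G)
  (D : path_space_data R root) :
  ~ bounded_geometry [set: path_space D] ->
  exists Y : set (path_space D), bounded_geometry Y /\ ~ property_A Y.
Proof. exact: bounded_geometry_without_property_A. Qed.
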